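(* For any integers $s\ge 1$ and $k\ge 1$, $$\hat r_s(C_n^k)=O(n).$$ That is, for all fixed integers $s\ge 1$ and $k\ge 1$ there is a constant $K=K(s,k)$ such that $\hat r_s(C_n^k)\le K n$ for all sufficiently large positive integers $n$.
   Context: All graphs are finite and simple. For graphs $G,H$ and a positive integer $s$, write $G\rightarrow (H)_s$ if every $s$-colouring of the edges of $G$ (every map from $E(G)$ to a set of $s$ colours) contains a monochromatic copy of $H$ as a (not necessarily induced) subgraph. The $s$-colour size-Ramsey number of $H$ is $\hat r_s(H)=\min\{|E(G)| : G\rightarrow (H)_s\}$. $C_n$ is the cycle on $n$ vertices. For a graph $H$ and a positive integer $k$, the $k$th power $H^k$ is the graph with vertex set $V(H)$ in which two distinct vertices are adjacent if and only if their distance in $H$ is at most $k$. *)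

(* Defs.v *)
From mathcomp Require Import all_boot.

Set Implicit Arguments.
Unset Strict Implicit.
Unset Printing Implicit Defensive.

Record sgraph := SGraph {
  vertex :> finType;
  adj : rel vertex;
  adj_sym : symmetric adj;
  adj_irr : irreflexive adj
}.

Definition edges (G : sgraph) : {set {set G}} :=
  [set [set p.1; p.2] | p : G * G & adj p.1 p.2].

Definition edge (G : sgraph) := {e : {set G} | e \in edges G}.

Definition mono_copy (G H : sgraph) (s : nat) (c : edge G -> 'I_s)
    (f : H -> G) : Prop :=
  [/\ injective f,
      forall x y, adj x y -> adj (f x) (f y)
    & exists i : 'I_s, forall x y, adj x y ->
        forall e : edge G, val e = [set f x; f y] -> c e = i].

Definition arrows (G H : sgraph) (s : nat) : Prop :=
  forall c : edge G -> 'I_s, exists f : H -> G, mono_copy c f.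

(* The minimum defining the size-Ramsey number, as a relation: [r] is attained
   and is a lower bound. *)
Definition is_size_ramsey (s : nat) (H : sgraph) (r : nat) : Prop :=
  (exists2 G : sgraph, arrows G H s & #|edges G| = r) /\
  (forall G : sgraph, arrows G H s -> r <= #|edges G|).

Lemma is_size_ramsey_unique s H r1 r2 :
  is_size_ramsey s H r1 -> is_size_ramsey s H r2 -> r1 = r2.
Proof.
move=> [[G1 a1 e1] m1] [[G2 a2 e2] m2].
by apply/eqP; rewrite eqn_leq -{1}e2 -{2}e1 m1 // m2.
Qed.

Definition has_path (G : sgraph) (d : nat) (x y : G) : bool :=
  [exists p : d.-tuple G, [&& path (@adj G) x p, uniq (x :: p) & last x p == y]].

(* A path has fewer than [#|G|] edges, so the search covers all possible
   lengths; the value is [#|G|] when [x] and [y] are not connected. *)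
Definition dist (G : sgraph) (x y : G) : nat :=
  find (fun d => has_path d x y) (iota 0 #|G|).

Lemma has_path_sym (G : sgraph) d : symmetric (@has_path G d).
Proof.
suff half (x y : G) : has_path d x y -> has_path d y x.
  by move=> x y; apply/idP/idP; apply: half.
case/existsP=> p /and3P[px ux /eqP lx].
have sz : size (rev (belast x p)) == d by rewrite size_rev size_belast size_tuple.
have eq_rev : y :: rev (belast x p) = rev (x :: p).
  by rewrite (lastI x p) rev_rcons lx.
apply/existsP; exists (Tuple sz); apply/and3P; split => /=.
- rewrite -lx rev_path; apply: sub_path px => u v.
  by rewrite adj_sym.
- by have := ux; rewrite -rev_uniq -eq_rev.
- by rewrite -(last_cons y) eq_rev rev_cons last_rcons.
Qed.

Lemma dist_sym (G : sgraph) (x y : G) : dist x y = dist y x.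
Proof. by apply: eq_find => d; apply: has_path_sym. Qed.

(* [connect] excludes pairs at infinite distance, on which [dist] is only a
   default value. *)
Definition power_adj (H : sgraph) (k : nat) : rel H :=
  fun x y => [&& x != y, connect (@adj H) x y & dist x y <= k].

Lemma power_adj_sym H k : symmetric (@power_adj H k).
Proof.
move=> x y; rewrite /power_adj eq_sym dist_sym.
by rewrite (sym_connect_sym (@adj_sym H)).
Qed.

Lemma power_adj_irr H k : irreflexive (@power_adj H k).
Proof. by move=> x; rewrite /power_adj eqxx. Qed.

Definition power (H : sgraph) (k : nat) : sgraph :=
  SGraph (@power_adj_sym H k) (@power_adj_irr H k).

(* [ordS] is the cyclic successor; this is the cycle C_n when [3 <= n]. *)
Definition cycle_adj (n : nat) : rel 'I_n :=
  fun i j => (i != j) && ((ordS i == j) || (ordS j == i)).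

Lemma cycle_adj_sym n : symmetric (@cycle_adj n).
Proof. by move=> i j; rewrite /cycle_adj eq_sym orbC. Qed.

Lemma cycle_adj_irr n : irreflexive (@cycle_adj n).
Proof. by move=> i; rewrite /cycle_adj eqxx. Qed.

Definition cycle_graph (n : nat) : sgraph :=
  SGraph (@cycle_adj_sym n) (@cycle_adj_irr n).

(* Main.v *)
Require Import Defs.
From mathcomp Require Import all_boot.
From mathcomp Require Import zify.
From Stdlib Require Import Classical.

(** Folding the cycle in two shows that [C_n] is contained in the square of the
    path on [n] vertices, so [C_n^k] is contained in the power of exponent [2 * k]
    of a path; it is enough to find a host with linearly many edges for a power
    of a path.

    The host joins the pairs at bounded distance in a bounded-degree graph [g] on
    linearly many vertices with the property that any two sets of [n] vertices
    have an edge of [g] between them ([exists_expander]). Bounded degree makes the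
    number of edges linear.

    Given a colouring with [s] colours, the colours are eliminated in turn. At
    each stage there is a family of large disjoint sets of vertices; each of these
    vertices carries a bounded configuration of nearby vertices, its tower, which
    contains large cliques in all the colours eliminated so far. A colour [c] has
    been eliminated when no two towers at nearby vertices of different sets of
    the family are linked in [c], that is, contain two cliques whose union is a
    clique in [c] ([family]). At the start no colour is eliminated and the towers
    are single vertices.

    To eliminate one more colour, follow a path of [g] through many sets of the
    family; expansion yields linearly many disjoint such paths
    ([disjoint_transversals]). All the towers met by a path are within bounded
    distance. After refining them so that each pair is joined in a single colour,
    that colour cannot be an eliminated one, because the towers are rich in
    cliques of the eliminated colours; Ramsey's theorem then merges several towers
    into one for a longer list of colours ([tow_extend]). A new colour [c]
    that occurs often is kept. Now consider the graph of the pairs of new towers that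
    are linked in [c]. If it has a path on [n] vertices, this path contains the
    wanted monochromatic power ([power_path_of_path]). Otherwise depth-first
    search finds many large sets without links between them ([dfs_split_all]),
    and [c] is eliminated as well. The new towers are built from separate groups
    of sets of the family, and a clique in an old colour cannot meet two of the
    towers merged into a new one; hence the old colours remain eliminated
    ([descent]).

    After [s] stages all colours would be eliminated, while the next stage still
    produces a new one; so a long path of links occurs on the way. *)

Set Implicit Arguments.
Unset Strict Implicit.
Unset Printing Implicit Defensive.

(** * Sequences: choice, pigeonhole and Ramsey's theorem *)

Lemma seq_choice (A B : eqType) (P : A -> B -> Prop) (l : seq A) :
  (forall x, x \in l -> exists y, P x y) ->
  exists2 m : seq (A * B), unzip1 m = l & forall z, z \in m -> P z.1 z.2.
Proof.
elim: l => [|x l IH] h; first by exists [::].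
have [y Py] := h x (mem_head _ _).
have [m <- Pm] := IH (fun z zl => h z (mem_behead (s := x :: l) zl)).
by exists ((x, y) :: m) => // z; rewrite inE => /predU1P[->|/Pm].
Qed.

Lemma pigeonhole (A : eqType) (F : finType) (f : A -> F) (n : nat) (l : seq A) :
  #|F| * n < size l -> exists c, n < count (fun x => f x == c) l.
Proof.
move=> h; apply/existsP; apply: contraLR h; rewrite negb_exists -leqNgt.
move=> /forallP h.
have -> : size l = \sum_(c : F) count (fun x => f x == c) l.
  elim: l {h} => [|x l IH] /=; first by rewrite big1.
  rewrite big_split -IH (bigD1 (f x)) //= eqxx big1 ?addn0 //.
  by move=> c; rewrite eq_sym => /negPf->.
rewrite -sum_nat_const; apply: leq_sum => c _.
by rewrite leqNgt; apply: h.
Qed.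

Lemma pigeonhole_subseq (A : eqType) (F : finType) (f : A -> F) n (l : seq A) :
  #|F| * n < size l ->
  exists c l', [/\ subseq l' l, size l' = n & all (fun x => f x == c) l'].
Proof.
move=> /(@pigeonhole _ _ f)[c hc]; exists c, (take n (filter (fun x => f x == c) l)).
split.
- exact: subseq_trans (take_subseq _ _) (filter_subseq _ _).
- by rewrite size_take size_filter hc.
- by apply/allP => x /mem_take; rewrite mem_filter => /andP[].
Qed.

(** Half of Ramsey's theorem: the colour of a pair is made to depend on its
    earlier member only, by repeatedly keeping a large colour class seen from
    the first remaining element. *)
Lemma ramsey_end_homogeneous (F : finType) (n : nat) :
  exists L, forall (A : eqType) (phi : A -> A -> F) (l : seq A), L <= size l ->
  exists m : seq (A * F), [/\ subseq (unzip1 m) l, size m = n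
    & pairwise (fun p q => phi p.1 q.1 == p.2) m].
Proof.
elim: n => [|n [L IH]].
  by exists 0 => A phi l _; exists [::]; split=> //; apply: sub0seq.
exists (#|F| * L).+2 => A phi [//|x l] /= hl.
have [|c [l' [sl' zl' hl']]] := @pigeonhole_subseq _ _ (phi x) L l.
  by move: hl; rewrite ltnS; apply: leq_trans.
have [|m [sm zm pm]] := IH A phi l'; first by rewrite zl'.
exists ((x, c) :: m); split=> /=.
- by rewrite eqxx (subseq_trans sm).
- by rewrite zm.
- rewrite pm andbT; apply/allP => p pm1 /=.
  by apply: (allP hl'); apply: (mem_subseq sm); apply: map_f.
Qed.

Lemma ramsey (F : finType) (n : nat) :
  exists L, forall (A : eqType) (phi : A -> A -> F) (l : seq A), L <= size l ->
  exists c l', [/\ subseq l' l, size l' = n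
    & pairwise (fun x y => phi x y == c) l'].
Proof.
have [L hL] := ramsey_end_homogeneous F (#|F| * n).+1.
exists L => A phi l /(hL A phi)[m [sm zm pm]].
have [|c [m' [sm' zm' cm']]] := @pigeonhole_subseq _ _ snd n m; first by rewrite zm.
exists c, (unzip1 m'); split.
- by apply: subseq_trans sm; apply: map_subseq.
- by rewrite size_map.
- rewrite pairwise_map.
  apply: (sub_in_pairwise (P := [pred p | p.2 == c])) cm' (subseq_pairwise sm' pm).
  by move=> p q /eqP pc _ /=; rewrite -pc.
Qed.

(** * Bounded-degree expanders *)

Lemma exists_subset_card (T : finType) (X : {set T}) (n : nat) :
  n <= #|X| -> exists2 Y : {set T}, Y \subset X & #|Y| = n.
Proof.
move=> h; exists [set x in take n (enum X)].
  by apply/subsetP => x; rewrite inE => /mem_take; rewrite mem_enum.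
rewrite cardsE (card_uniqP _) ?take_uniq ?enum_uniq //.
by rewrite size_take -cardE; case: ltngtP h.
Qed.

(** The count is exact because the out-edges are chosen independently; it feeds
    a union bound over all pairs of sets. *)
Lemma card_avoiding (W : finType) (d : nat) (A B : {set W}) :
  #|[set f : {ffun W * 'I_d -> W} |
      [forall u in A, forall i, f (u, i) \notin B]]|
  = (#|W| - #|B|) ^ (#|A| * d) * #|W| ^ ((#|W| - #|A|) * d).
Proof.
pose F (p : W * 'I_d) : pred W :=
  if p.1 \in A then [predC B] else predT.
transitivity #|family F|.
  rewrite cardsE; apply: eq_card => f; rewrite !inE.
  apply/forall_inP/familyP => [h [u i]|h u uA].
    rewrite /F /=; case: ifP => // uA.
    by have /forallP/(_ i) := h u uA.
  apply/forallP => i; have := h (u, i).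
  by rewrite /F /= uA.
rewrite card_family foldrE big_image /= (bigID (fun p : W * 'I_d => p.1 \in A)) /=.
congr (_ * _).
- rewrite (eq_bigr (fun=> #|W| - #|B|)); last first.
    move=> p pA; rewrite /F pA.
    by rewrite -(cardC (mem B)) addKn; apply: eq_card => x; rewrite !inE.
  rewrite prod_nat_const; congr (_ ^ _).
  rewrite -[d in RHS]card_ord -cardsT -cardsX.
  by apply: eq_card => p; rewrite !inE andbT.
- rewrite (eq_bigr (fun=> #|W|)); last first.
    move=> p /negPf pA; rewrite /F pA.
    by apply: eq_card => x; rewrite !inE.
  rewrite prod_nat_const; congr (_ ^ _).
  rewrite -[d in RHS]card_ord -(cardsT 'I_d).
  have -> : #|W| - #|A| = #|~: A| by rewrite -(cardsC A) addKn.
  rewrite -cardsX.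
  by apply: eq_card => p; rewrite !inE andbT.
Qed.

Lemma bernoulli_nat (m d : nat) : m ^ d * (m + d) <= m * m.+1 ^ d.
Proof.
elim: d => [|d IH]; first by rewrite !expn0; lia.
rewrite !expnS.
apply: (@leq_trans (m.+1 * (m ^ d * (m + d)))).
  by have := expn_gt0 m d; nia.
by rewrite [m * _]mulnCA leq_pmul2l.
Qed.

(** There are at most [4 ^ (Q * a)] pairs of sets, so the union bound succeeds as
    soon as [4 ^ Q * (Q - 1) ^ d < Q ^ d]. This condition does not involve [a]. *)
Lemma exists_expanding_function (Q : nat) : 1 < Q -> exists d, forall a, 0 < a ->
  exists f : {ffun 'I_(Q * a) * 'I_d -> 'I_(Q * a)}, forall A B : {set 'I_(Q * a)},
    a <= #|A| -> a <= #|B| -> exists u i, u \in A /\ f (u, i) \in B.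
Proof.
case: Q => [//|[//|Q _]]; set q := Q.+1.
pose d := 4 ^ q.+1 * q; exists d => a a0.
have key : 4 ^ q.+1 * q ^ d < q.+1 ^ d.
  have := bernoulli_nat q d; have : 0 < q ^ d by rewrite expn_gt0.
  rewrite {3}/d.
  have q0 : 0 < q by [].
  move: (q ^ d) (q.+1 ^ d) (4 ^ q.+1) => x y z x0 h.
  rewrite -(ltn_pmul2l q0); nia.
set W := 'I_(q.+1 * a).
pose bad (p : {set W} * {set W}) := [set f : {ffun W * 'I_d -> W} |
      [forall u in p.1, forall i, f (u, i) \notin p.2]].
pose P (p : {set W} * {set W}) := (#|p.1| == a) && (#|p.2| == a).
have cW : #|W| = q.+1 * a by rewrite card_ord.
have small : #|\bigcup_(p | P p) bad p| < #|{ffun W * 'I_d -> W}|.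
  apply: leq_ltn_trans (_ : \sum_(p | P p) #|bad p| < _).
    elim/big_rec2: _ => [|p n X _ IH]; first by rewrite cards0.
    by apply: leq_trans (leq_card_setU _ _) _; rewrite leq_add2l.
  pose c := (q * a) ^ (a * d) * (q.+1 * a) ^ (q * a * d).
  rewrite (eq_bigr (fun=> c)); last first.
    move=> p /andP[/eqP p1 /eqP p2]; rewrite card_avoiding p1 p2 cW /c.
    by rewrite mulSn addKn.
  rewrite sum_nat_const.
  have hP : #|P| <= 4 ^ (q.+1 * a).
    apply: leq_trans (max_card _) _.
    by rewrite card_prod -cardsT -powersetT card_powerset cardsT cW -expnMn.
  apply: leq_ltn_trans (leq_mul hP (leqnn _)) _.
  rewrite card_ffun card_prod cW (card_ord d).
  have -> : (q.+1 * a) ^ (q.+1 * a * d) =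
            (q.+1 * a) ^ (a * d) * (q.+1 * a) ^ (q * a * d).
    by rewrite -expnD; congr (_ ^ _); lia.
  rewrite mulnA ltn_pmul2r ?expn_gt0 ?muln_gt0 ?a0 //.
  rewrite [a * d]mulnC !expnMn mulnA ltn_pmul2r ?expn_gt0 ?a0 //.
  by rewrite (expnM 4 q.+1 a) (expnM q d a) (expnM q.+1 d a) -expnMn ltn_exp2r.
have [f hf] : exists f, f \notin \bigcup_(p | P p) bad p.
  apply/existsP; apply: contraLR small; rewrite negb_exists -leqNgt.
  move=> /forallP h; apply/subset_leq_card/subsetP => f _.
  by move: (h f); rewrite negbK.
exists f => A B /exists_subset_card[A' sA A'a] /exists_subset_card[B' sB B'a].
have : f \notin bad (A', B').
  apply: contra hf => hf; apply/bigcupP; exists (A', B') => //.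
  by rewrite /P /= A'a B'a !eqxx.
rewrite inE /= => /forall_inPn[u uA /forallPn[i]]; rewrite negbK => fB.
by exists u, i; rewrite (subsetP sA) ?(subsetP sB).
Qed.

Definition expands (V : finType) (g : rel V) (a : nat) :=
  forall A B : {set V}, a <= #|A| -> a <= #|B| ->
    exists u v, [/\ u \in A, v \in B & g u v].

(** The in-degrees of a function with few out-edges average to [d], so at most
    half of the vertices have in-degree above [2 * d]; the others induce a graph
    of bounded degree that inherits the expansion. *)
Lemma exists_expander (Lam : nat) : 0 < Lam -> exists D, forall a, 0 < a ->
  exists (V : finType) (g : rel V),
    [/\ reflexive g, symmetric g, expands g a,
        Lam * a <= #|V| <= Lam.*2 * a & forall u, #|[set v | g u v]| <= D].
Proof.
move=> Lam0; have [|d hd] := @exists_expanding_function Lam.*2; first by lia.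
exists (1 + (d + d.*2)) => a a0; have [f hf] := hd a a0.
set W := 'I_(Lam.*2 * a) in f hf *.
have cW : #|W| = Lam.*2 * a by rewrite card_ord.
pose indeg v := #|[set p | f p == v]|.
pose low := [set v | indeg v <= d.*2].
have sum_in : \sum_v indeg v = #|W| * d.
  rewrite -[d in RHS]card_ord -card_prod -cardsT -sum1_card.
  rewrite (partition_big f predT) //=; apply: eq_bigr => v _.
  by rewrite /indeg -sum1_card; apply: eq_bigl => p; rewrite !inE.
have hlow : Lam * a <= #|low|.
  have h1 : #|~: low| * d.*2.+1 <= #|W| * d.
    rewrite -sum_in -sum_nat_const [X in _ <= X](bigID (mem (~: low))) /=.
    apply: leq_trans (leq_addr _ _); apply: leq_sum => v.
    by rewrite !inE -ltnNge.
  have := cardsC low; rewrite cW in h1 *; nia.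
pose V := {v : W | v \in low} : finType.
pose g (u v : V) := [|| u == v, [exists i, f (val u, i) == val v]
                     | [exists i, f (val v, i) == val u]].
have valI : injective (val : V -> W) by apply: val_inj.
exists V, g; split.
- by move=> u; rewrite /g eqxx.
- by move=> u v; rewrite /g eq_sym; congr orb; rewrite orbC.
- move=> A B hA hB.
  have [||w [i [/imsetP[u uA wu] /imsetP[v vB fv]]]] := hf (val @: A) (val @: B).
  + by rewrite card_imset.
  + by rewrite card_imset.
  + exists u, v; split=> //; rewrite /g; apply/or3P/Or32/existsP.
    by exists i; rewrite -wu fv.
- rewrite card_sig (_ : #|_| = #|low|); last by apply: eq_card => v; rewrite !inE.
  rewrite hlow; apply: leq_trans (max_card _) _; by rewrite cW.
- move=> u.
  rewrite -(card_imset _ valI).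
  have -> : 1 + (d + d.*2) = 1 + (#|'I_d| + d.*2) by rewrite card_ord.
  have hu : indeg (val u) <= d.*2 by have := valP u; rewrite inE.
  pose S2 := [set f (val u, i) | i : 'I_d].
  pose S3 := [set p.1 | p in [set p | f p == val u]].
  apply: (@leq_trans #|val u |: (S2 :|: S3)|).
    apply/subset_leq_card/subsetP => w /imsetP[v].
    rewrite inE => /or3P[/eqP<-|/existsP[i /eqP fi]|/existsP[i fi]] ->.
    + by rewrite !inE eqxx.
    + rewrite !inE -fi; apply/orP; right; apply/orP; left.
      by apply/imsetP; exists i.
    + rewrite !inE; apply/orP; right; apply/orP; right.
      by apply/imsetP; exists (val v, i); rewrite ?inE.
  rewrite cardsU1 leq_add //; first by case: (_ \notin _).
  apply: leq_trans (leq_card_setU _ _) _; apply: leq_add.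
    exact: leq_trans (leq_imset_card _ _) (max_card _).
  exact: leq_trans (leq_imset_card _ _) hu.
Qed.

(** * Balls *)

Fixpoint near (V : finType) (g : rel V) (r : nat) : rel V :=
  if r is r'.+1 then fun x y => [exists z, g x z && near g r' z y]
  else fun x y => x == y.

Lemma near_add (V : finType) (g : rel V) r r' x y z :
  near g r x y -> near g r' y z -> near g (r + r') x z.
Proof.
elim: r x => [|r IH] x /=; first by move/eqP->.
case/existsP=> w /andP[xw wy] yz; apply/existsP; exists w.
by rewrite xw IH.
Qed.

Lemma near1 (V : finType) (g : rel V) x y : g x y -> near g 1 x y.
Proof. by move=> xy; apply/existsP; exists y; rewrite xy /=. Qed.

Lemma near_sym (V : finType) (g : rel V) r : symmetric g -> symmetric (near g r).
Proof.
move=> gS; suff half x y : near g r x y -> near g r y x.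
  by move=> x y; apply/idP/idP; apply: half.
elim: r x => [|r IH] x; first by rewrite /= eq_sym.
case/existsP=> w /andP[xw /IH yw]; rewrite -addn1.
by apply: near_add yw (near1 _); rewrite gS.
Qed.

Lemma near_refl (V : finType) (g : rel V) r : reflexive g -> reflexive (near g r).
Proof.
by move=> gR; elim: r => //= r IH x; apply/existsP; exists x; rewrite gR IH.
Qed.

Lemma near_leq (V : finType) (g : rel V) r r' x y :
  reflexive g -> r <= r' -> near g r x y -> near g r' x y.
Proof.
by move=> gR le xy; rewrite -(subnKC le); apply: near_add xy (near_refl _ gR _).
Qed.

Lemma near_path (V : finType) (g : rel V) x p y :
  reflexive g -> path g x p -> y \in x :: p -> near g (size p) x y.
Proof.
move=> gR; elim: p x => [|z p IH] x /=; first by rewrite inE eq_sym.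
case/andP=> xz zp; rewrite inE => /predU1P[->|yp].
  exact: (near_refl _.+1).
by apply/existsP; exists z; rewrite xz IH.
Qed.

Lemma card_near (V : finType) (g : rel V) D r x :
  (forall u, #|[set v | g u v]| <= D) -> #|[set y | near g r x y]| <= D ^ r.
Proof.
move=> gD; elim: r x => [|r IH] x /=.
  by rewrite (eq_card (B := pred1 x)) ?card1 // => y; rewrite !inE eq_sym.
apply: leq_trans (_ : #|\bigcup_(z in [set v | g x v]) [set y | near g r z y]| <= _).
  apply/subset_leq_card/subsetP => y; rewrite inE => /existsP[z /andP[xz zy]].
  by apply/bigcupP; exists z; rewrite inE.
apply: leq_trans (_ : \sum_(z in [set v | g x v]) D ^ r <= _).
  elim/big_rec2: _ => [|z n X _ le]; first by rewrite cards0.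
  by apply: leq_trans (leq_card_setU _ _) _; rewrite leq_add.
by rewrite sum_nat_const expnS leq_mul2r gD orbT.
Qed.

(** * Depth-first search *)

Definition noedge (V : finType) (e : rel V) (A B : {set V}) :=
  [forall u in A, forall v in B, ~~ e u v].

Lemma noedgeP (V : finType) (e : rel V) (A B : {set V}) :
  reflect (forall u v, u \in A -> v \in B -> ~~ e u v) (noedge e A B).
Proof.
apply: (iffP forall_inP) => [h u v uA vB|h u uA].
  by have /forall_inP/(_ v vB) := h u uA.
by apply/forall_inP => v vB; apply: h.
Qed.

(** Depth-first search: [S] collects the exhausted vertices and [U] is the
    current path, so no edge leaves [S] for the unexplored vertices. The search
    is stopped as soon as [S] has [b] vertices in [A] or in [B]; as [U] is short,
    the other set then still has [b] unexplored vertices. *)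
Lemma dfs_split (V : finType) (e : rel V) (a b : nat) (A B : {set V}) :
  symmetric e -> 0 < b -> b.*2 + a <= #|A| -> b.*2 + a <= #|B| ->
  (exists us, [/\ size us = a, uniq us, {subset us <= A :|: B} & sorted e us]) \/
  exists A' B' : {set V},
    [/\ A' \subset A, B' \subset B, b <= #|A'|, b <= #|B'| & noedge e A' B'].
Proof.
move=> eS b0 hA hB.
pose T (S : {set V}) (U : seq V) := (A :|: B) :\: (S :|: [set x in U]).
suff main n (S : {set V}) (U : seq V) :
    [/\ uniq U, {subset U <= A :|: B}, {in U, forall x, x \notin S}, sorted e U
      & size U <= a] ->
    [/\ #|S :&: A| <= b, #|S :&: B| <= b & noedge e S (T S U)] ->
    (#|V|.*2).+1 <= n + (#|S|.*2 + size U) ->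
    (exists us, [/\ size us = a, uniq us, {subset us <= A :|: B} & sorted e us]) \/
    exists A' B' : {set V},
      [/\ A' \subset A, B' \subset B, b <= #|A'|, b <= #|B'| & noedge e A' B'].
  apply: (main (#|V|.*2).+1 set0 [::]) => //; last by rewrite cards0 addn0.
  split; try by rewrite set0I cards0.
  by apply/noedgeP => u v; rewrite inE.
elim: n S U => [|n IH] S U [uU UAB US sU zU] [SA SB noE] meas.
  have cU : #|[set x in U]| = size U by rewrite cardsE; apply/card_uniqP.
  have := max_card (mem (S :|: [set x in U])); rewrite cardsU cU.
  rewrite (_ : S :&: _ = set0) ?cards0; first by lia.
  by apply/setP => x; rewrite !inE andbC; case: (boolP (x \in U)) => //= /US/negPf.
have big (X : {set V}) : X \subset A :|: B -> #|S :&: X| <= b -> b.*2 + a <= #|X| ->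
    b <= #|T S U :&: X|.
  move=> XAB SX hX.
  have cU : #|[set x in U]| <= size U by rewrite cardsE card_size.
  have : X \subset (T S U :&: X) :|: ((S :&: X) :|: [set x in U]).
    apply/subsetP => x xX; rewrite !inE xX !andbT.
    have := subsetP XAB x xX; rewrite inE => ->.
    by case: (x \in S) => //=; case: (x \in U).
  move/subset_leq_card/leq_trans/(_ (leq_card_setU _ _)).
  have : #|S :&: X :|: [set x in U]| <= #|S :&: X| + #|[set x in U]|.
    exact: leq_card_setU.
  lia.
have [SAb|SAb] := eqVneq #|S :&: A| b.
  right; exists (S :&: A), (T S U :&: B); rewrite !subsetIr SAb leqnn.
  split=> //; first by apply: big => //; apply: subsetUr.
  by apply/noedgeP => u v /setIP[uS _] /setIP[vT _]; apply: (noedgeP _ _ _ noE).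
have [SBb|SBb] := eqVneq #|S :&: B| b.
  right; exists (T S U :&: A), (S :&: B); rewrite !subsetIr SBb leqnn.
  split=> //; first by apply: big => //; apply: subsetUl.
  apply/noedgeP => u v /setIP[uT _] /setIP[vS _]; rewrite eS.
  exact: (noedgeP _ _ _ noE).
have [zUa|zUa] := eqVneq (size U) a; first by left; exists U.
have Tsub t : T S (t :: U) \subset T S U.
  by apply/subsetP => x; rewrite !inE !negb_or => /andP[/and3P[-> _ ->] ->].
have noET t : noedge e S (T S (t :: U)).
  by apply/noedgeP => u v uS vT; apply: (noedgeP _ _ _ noE) => //; apply: (subsetP (Tsub t)).
have go t : t \in T S U -> path e t U ->
    (exists us, [/\ size us = a, uniq us, {subset us <= A :|: B} & sorted e us]) \/
    exists A' B' : {set V},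
      [/\ A' \subset A, B' \subset B, b <= #|A'|, b <= #|B'| & noedge e A' B'].
  move=> tT tU; have := tT; rewrite in_setD in_setU inE negb_or => /andP[/andP[tS tnU] tAB].
  apply: (IH S (t :: U)) => //=; last by move: meas; clear; rewrite addSn !addnS.
  split=> //=.
  - by rewrite tnU.
  - by move=> x; rewrite inE => /predU1P[->|/UAB].
  - by move=> x; rewrite inE => /predU1P[->|/US].
  - by rewrite ltn_neqAle zUa.
case: U => [|u U] in uU UAB US sU zU noE meas big zUa Tsub noET go *.
  have /card_gt0P[t] : 0 < #|T S [::] :&: A|.
    by apply: leq_trans b0 _; apply: big => //; apply: subsetUl.
  by case/setIP => tT _; apply: (go t).
have [/existsP[t /andP[tT ut]]|] := boolP [exists t, (t \in T S (u :: U)) && e u t].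
  by apply: (go t) => //=; rewrite eS ut.
rewrite negb_exists => /forallP noU.
case/andP: uU => unU uU.
have uS : u \notin S by apply: US; rewrite mem_head.
have TS : T (u |: S) U = T S (u :: U).
  by apply/setP => x; rewrite !inE; case: (x == u) (x \in S) => [] [].
apply: (IH (u |: S) U).
- split=> //.
  + by move=> x xU; apply: UAB; rewrite inE xU orbT.
  + move=> x xU; rewrite !inE negb_or US ?andbT; last by rewrite inE xU orbT.
    by apply: contraNneq unU => <-.
  + exact: path_sorted sU.
  + exact: ltnW.
- have bound (X : {set V}) : #|S :&: X| <= b -> #|S :&: X| != b ->
      #|(u |: S) :&: X| <= b.
    move=> h1 h2; rewrite setIUl; apply: leq_trans (leq_card_setU _ _) _.
    apply: leq_trans (_ : 1 + #|S :&: X| <= _); last by rewrite add1n ltn_neqAle h2.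
    by rewrite leq_add2r (leq_trans (subset_leq_card (subsetIl _ _))) ?cards1.
  split; [exact: bound|exact: bound|rewrite TS].
  apply/noedgeP => x y /setU1P[->|xS] yT; last exact: (noedgeP _ _ _ noE).
  by have := noU y; rewrite yT.
- by move: meas; rewrite cardsU1 uS /=; lia.
Qed.

Lemma all2_trans_sub (A B C : Type) (P : A -> B -> bool) (Q : B -> C -> bool)
    (R : A -> C -> bool) xs ys zs :
  (forall x y z, P x y -> Q y z -> R x z) ->
  all2 P xs ys -> all2 Q ys zs -> all2 R xs zs.
Proof.
move=> h; elim: xs ys zs => [|x xs IH] [|y ys] [|z zs] //=.
by case/andP=> xy xys /andP[yz yzs]; rewrite (h x y z) // (IH ys).
Qed.

Lemma all2_pairwise (A B : Type) (P : A -> B -> bool) (R : rel A) (Q : rel B) xs ys :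
  (forall x y x' y', P x y -> P x' y' -> Q y y' -> R x x') ->
  all2 P xs ys -> pairwise Q ys -> pairwise R xs.
Proof.
move=> h; elim: xs ys => [|x xs IH] [|y ys] //= /andP[xy xys] /andP[yQ ysQ].
rewrite (IH ys) // andbT.
elim: xs ys xys yQ {IH ysQ} => [|x' xs IH] [|y' ys] //= /andP[xy' xys] /andP[yy' yQ].
by rewrite (h x y x' y') // (IH ys).
Qed.

Lemma all2_mem (A B : eqType) (P : A -> B -> bool) xs ys x :
  all2 P xs ys -> x \in xs -> exists2 y, y \in ys & P x y.
Proof.
elim: xs ys => [|x' xs IH] [|y ys] //= /andP[xy xys].
rewrite inE => /predU1P[->|xin]; first by exists y; rewrite ?mem_head.
by have [z zys xz] := IH _ xys xin; exists z; rewrite // inE zys orbT.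
Qed.

Definition large_sub (V : finType) (n : nat) (Y X : {set V}) :=
  (Y \subset X) && (n <= #|Y|).

Definition long_path (V : finType) (e : rel V) (a : nat) (Xs : seq {set V}) :=
  exists us, [/\ size us = a, uniq us, sorted e us
               & forall u, u \in us -> exists2 X, X \in Xs & u \in X].

Lemma dfs_split_one (V : finType) (e : rel V) (a Lam : nat) X (Xs : seq {set V}) :
  symmetric e -> 0 < a -> 0 < Lam ->
  {in X :: Xs, forall Y : {set V}, iter (size Xs) (fun x => x.*2.+1) Lam * a <= #|Y|} ->
  long_path e a (X :: Xs) \/
  exists X' Ys, [/\ large_sub (Lam * a) X' X, all2 (large_sub (Lam * a)) Ys Xs
                  & all (noedge e X') Ys].
Proof.
move=> eS a0 Lam0; elim: Xs X => [|Y Xs IH] X hX.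
  by right; exists X, [::]; rewrite /large_sub subxx hX ?mem_head.
set Lam1 := iter (size Xs) (fun x => x.*2.+1) Lam.
have le1 : Lam <= Lam1 by rewrite /Lam1; elim: (size Xs) => //= n; lia.
have szY Z : Z \in [:: X, Y & Xs] -> (Lam1 * a).*2 + a <= #|Z|.
  by move=> /hX; rewrite /= -/Lam1 mulSn doubleMl addnC.
have [||| [us [zus uus usXY sus]]|[X1 [Y1 [sX sY hX1 hY1 noE]]]] :=
    @dfs_split V e a (Lam1 * a) X Y eS.
- by rewrite muln_gt0 a0 (leq_trans Lam0).
- by apply: szY; rewrite mem_head.
- by apply: szY; rewrite !inE eqxx orbT.
- left; exists us; split=> // u /usXY/setUP[uX|uY].
    by exists X; rewrite // mem_head.
  by exists Y; rewrite // !inE eqxx orbT.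
have [Z|[us [zus uus sus hus]]|[X' [Ys [sX' sYs noX']]]] := IH X1.
- rewrite inE => /predU1P[->//|ZXs].
  apply: leq_trans (szY Z _); last by rewrite !inE ZXs !orbT.
  by rewrite -/Lam1; lia.
- left; exists us; split=> // u /hus[Z]; rewrite inE => /predU1P[->|ZXs] uZ.
    by exists X; rewrite ?mem_head ?(subsetP sX).
  by exists Z; rewrite // !inE ZXs !orbT.
- right; exists X', (Y1 :: Ys); case/andP: sX' => sX' hX'; split=> /=.
  + by rewrite /large_sub (subset_trans sX').
  + by rewrite /large_sub sY sYs (leq_trans _ hY1) // leq_mul2r le1 orbT.
  + rewrite noX' andbT; apply/noedgeP => u v uX' vY1.
    by apply: (noedgeP _ _ _ noE) => //; apply: (subsetP sX').
Qed.

Lemma dfs_split_all (L Lam : nat) : 0 < Lam -> exists2 Lam', 0 < Lam' &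
  forall (V : finType) (e : rel V) (a : nat) (Xs : seq {set V}),
  symmetric e -> 0 < a -> size Xs = L ->
  {in Xs, forall X : {set V}, Lam' * a <= #|X|} ->
  long_path e a Xs \/
  exists2 Ys, all2 (large_sub (Lam * a)) Ys Xs & pairwise (noedge e) Ys.
Proof.
move=> Lam0; suff [Lam' le h] : exists2 Lam', Lam <= Lam' &
    forall (V : finType) (e : rel V) (a : nat) (Xs : seq {set V}),
    symmetric e -> 0 < a -> size Xs = L ->
    {in Xs, forall X : {set V}, Lam' * a <= #|X|} ->
    long_path e a Xs \/
    exists2 Ys, all2 (large_sub (Lam * a)) Ys Xs & pairwise (noedge e) Ys.
  by exists Lam'; first exact: leq_trans Lam0 le.
elim: L => [|L [Lam1 le1 IH]].
  by exists Lam => // V e a [|//] _ _ _ _; right; exists [::].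
exists (iter L (fun x => x.*2.+1) Lam1).
  by apply: leq_trans le1 _; elim: {IH} L => //= n; lia.
move=> V e a [|X Xs] // eS a0 [zXs] hX; rewrite -zXs in hX.
have [lp|[X' [Ys [sX' sYs noX']]]] := dfs_split_one eS a0 (leq_trans Lam0 le1) hX.
  by left.
have zYs : size Ys = L by rewrite -zXs; move: sYs; rewrite all2E => /andP[/eqP].
have [Y|[us [zus uus sus hus]]|[Zs sZs noZs]] := IH V e a Ys eS a0 zYs.
- by case/(all2_mem sYs)=> Z _ /andP[].
- left; exists us; split=> // u /hus[Y /(all2_mem sYs)[Z ZXs /andP[/subsetP sYZ _]] uY].
  by exists Z; rewrite ?sYZ // inE ZXs orbT.
- right; exists (X' :: Zs) => /=.
    case/andP: sX' => sX' hX'; rewrite /large_sub sX' (leq_trans _ hX') ?leq_mul2r ?le1 ?orbT //=.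
    apply: all2_trans_sub sZs sYs => A B C /andP[sA hA] /andP[sB _].
    by rewrite hA (subset_trans sA).
  rewrite noZs andbT; apply/allP => Z /(all2_mem sZs)[Y YYs /andP[/subsetP sZY _]].
  apply/noedgeP => u v uX' vZ.
  by apply: (noedgeP _ _ _ (allP noX' Y YYs)) => //; apply: sZY.
Qed.

(** * Towers *)

Definition incl (V : eqType) (ys xs : seq V) := all [in xs] ys.

Lemma inclP (V : eqType) (ys xs : seq V) : reflect {subset ys <= xs} (incl ys xs).
Proof. exact: allP. Qed.

Lemma incl_trans (V : eqType) (ys xs zs : seq V) :
  incl xs ys -> incl ys zs -> incl xs zs.
Proof. by move=> /inclP h /inclP h'; apply/inclP => x /h/h'. Qed.

Lemma allrel_incl (V : eqType) (r : rel V) xs ys xs' ys' :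
  incl xs' xs -> incl ys' ys -> allrel r xs ys -> allrel r xs' ys'.
Proof.
by move=> /inclP hx /inclP hy /allrelP h; apply/allrelP => x y /hx xi /hy; apply: h.
Qed.

Lemma pairwise_mem (A : eqType) (r : rel A) (l : seq A) x y :
  pairwise r l -> x \in l -> y \in l -> x != y -> r x y || r y x.
Proof.
elim: l => //= z l IH /andP[/allP zl pl].
rewrite !inE => /predU1P[->|xl] /predU1P[->|yl]; rewrite ?eqxx // => nxy.
- by rewrite zl.
- by rewrite zl ?orbT.
- exact: IH.
Qed.

Lemma all2_nth (A B : Type) (P : A -> B -> bool) xs ys x0 y0 i :
  all2 P xs ys -> i < size xs -> P (nth x0 xs i) (nth y0 ys i).
Proof.
elim: xs ys i => [|x xs IH] [|y ys] //= [|i] /andP[xy xys] //=.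
exact: IH.
Qed.

(** Adjacency in colour [c]; asking for distinct endpoints makes a sequence
    whose entries are pairwise related duplicate-free. *)
Definition cc (V T : eqType) (chi : V -> V -> T) (c : T) : rel V :=
  fun x y => (x != y) && (chi x y == c).

Lemma cc_sym (V T : eqType) (chi : V -> V -> T) c :
  (forall x y, chi x y = chi y x) -> symmetric (cc chi c).
Proof. by move=> chiS x y; rewrite /cc eq_sym chiS. Qed.

(** A tower contains cliques of size [p] in each colour of its list, and so does
    one of the classes whenever its vertices are partitioned into boundedly many
    classes and [p] is large. Separate cliques would not survive such a partition
    in the same class. *)
Fixpoint tow (V T : eqType) (chi : V -> V -> T) (C : seq T) (p : nat) (xs : seq V)
    : Prop :=
  if C is c :: C' then
    exists yss, [/\ size yss = p, forall ys, ys \in yss -> tow chi C' p ys,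
      pairwise (allrel (cc chi c)) yss & xs = flatten yss]
  else exists x, xs = [:: x].

Lemma size_tow (V T : eqType) (chi : V -> V -> T) C p xs :
  tow chi C p xs -> size xs = p ^ size C.
Proof.
elim: C xs => [|c C IH] xs /=; first by case=> x ->.
case=> yss [zyss h _ ->]; rewrite size_flatten expnS -[X in X * _]zyss.
elim: yss h {zyss} => //= ys yss IH' h; rewrite mulSn IH'; last first.
  by move=> zs zin; apply: h; rewrite inE zin orbT.
by rewrite (IH ys (h _ (mem_head _ _))).
Qed.

Lemma tow_neq0 (V T : eqType) (chi : V -> V -> T) C p xs :
  0 < p -> tow chi C p xs -> xs != [::].
Proof. by move=> p0 /size_tow zxs; rewrite -size_eq0 zxs -lt0n expn_gt0 p0. Qed.

Lemma tow_color (V T : eqType) (chi : V -> V -> T) C p xs x y :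
  (forall x y, chi x y = chi y x) -> tow chi C p xs ->
  x \in xs -> y \in xs -> x != y -> chi x y \in C.
Proof.
move=> chiS; elim: C xs => [|c C IH] xs /=.
  by case=> z ->; rewrite !inE => /eqP-> /eqP->; rewrite eqxx.
case=> yss [_ h pw ->] /flattenP[ys yin xys] /flattenP[zs zin yzs] nxy.
have [e|ne] := eqVneq ys zs.
  by rewrite inE (IH ys) ?orbT //; [apply: h|rewrite e].
rewrite inE; apply/orP; left.
case/orP: (pairwise_mem pw yin zin ne) => /allrelP hr.
  by have /andP[] := hr x y xys yzs.
by have /andP[] := hr y x yzs xys; rewrite chiS.
Qed.

(** The pairs that are not joined in the colour [c] on top of a tower are those
    inside one of its groups. *)
Lemma tow_not_cc_trans (V T : eqType) (chi : V -> V -> T) c C p xs x y z :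
  (forall x y, chi x y = chi y x) -> c \notin C -> tow chi (c :: C) p xs ->
  x \in xs -> y \in xs -> z \in xs ->
  ~~ cc chi c x y -> ~~ cc chi c y z -> ~~ cc chi c x z.
Proof.
move=> chiS cC [yss [_ h pw ->]] /flattenP[xs' xin xxs] /flattenP[ys' yin yys].
case/flattenP=> zs' zin zzs.
have same us vs u v : us \in yss -> vs \in yss -> u \in us -> v \in vs ->
    ~~ cc chi c u v -> us = vs.
  move=> uin vin uus vvs; apply: contraNeq => /(pairwise_mem pw uin vin).
  case/orP=> /allrelP hr; first exact: hr.
  by rewrite cc_sym //; apply: hr.
move=> /(same _ _ _ _ xin yin xxs yys) e1 /(same _ _ _ _ yin zin yys zzs) e2.
apply/negP => /andP[nxz /eqP e]; move/negP: cC; apply; rewrite -e.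
by apply: (tow_color chiS (h _ xin)) => //; rewrite e1 e2.
Qed.

Lemma tow_clique (V T : eqType) (chi : V -> V -> T) c C p xs :
  0 < p -> tow chi C p xs -> c \in C ->
  exists I, [/\ size I = p, incl I xs & pairwise (cc chi c) I].
Proof.
move=> p0; elim: C xs => //= d C IH xs [yss [zyss h pw ->]].
have [->|ncd] := eqVneq c d; last first.
  rewrite inE (negPf ncd) /= => cC.
  case: yss zyss h pw => [e|ys yss _ h _]; first by rewrite -e in p0.
  have [I [zI Iys cI]] := IH ys (h _ (mem_head _ _)) cC.
  exists I; split=> //; apply/inclP => x /(inclP _ _ Iys) xys.
  by rewrite /= mem_cat xys.
have [ys yin|m e hm] := @seq_choice _ _ (fun (ys : seq V) (x : V) => x \in ys) yss.
  have := tow_neq0 p0 (h ys yin).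
  by case: ys {yin} => // y ys _; exists y; rewrite mem_head.
exists (unzip2 m); split.
- by rewrite -zyss -e !size_map.
- apply/inclP => x /mapP[z zm ->]; apply/flattenP; exists z.1; last exact: hm.
  by rewrite -e map_f.
- move: pw; rewrite -e !pairwise_map.
  apply: (sub_in_pairwise (P := [in m])); last exact/allP.
  by move=> u v um vm /= /allrelP; apply; apply: hm.
Qed.

(** The groups of a tower are treated separately, and a colour shared by many
    groups is kept. *)
Lemma tow_ramsey (F : finType) (j p' : nat) : exists p0, forall p, p0 <= p ->
  forall (V T : eqType) (chi : V -> V -> T) (C : seq T) (xs : seq V) (f : V -> F),
  size C = j -> tow chi C p xs ->
  exists ys c, [/\ incl ys xs, tow chi C p' ys & forall y, y \in ys -> f y = c].
Proof.
elim: j => [|j [p0 IH]].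
  exists 0 => p _ V T chi [|//] xs f _ [x ->].
  exists [:: x], (f x); split=> /=; [by rewrite /incl /= mem_head|by exists x|].
  by move=> y; rewrite inE => /eqP->.
exists (maxn p0 (#|F| * p').+1) => p; rewrite geq_max => /andP[le0 leF].
move=> V T chi [//|c C] xs f [zC] [yss [zyss h pw ->]].
have [ys yin|m e hm] := @seq_choice _ _ (fun ys (z : F * seq V) =>
    [/\ incl z.2 ys, tow chi C p' z.2 & forall y, y \in z.2 -> f y = z.1]) yss.
  have [zs [d hz]] := IH p le0 V T chi C ys f zC (h ys yin).
  by exists (d, zs).
have [|d [m' [sm' zm' cm']]] :=
    @pigeonhole_subseq _ _ (fun z : seq V * (F * seq V) => z.2.1) p' m.
  by rewrite -(size_map fst) -/(unzip1 m) e zyss.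
exists (flatten [seq z.2.2 | z <- m']), d; split.
- apply/inclP => x /flattenP[zs /mapP[z /(mem_subseq sm') zm ->] xz].
  apply/flattenP; exists z.1; first by rewrite -e map_f.
  by have [/inclP/(_ _ xz)] := hm z zm.
- exists [seq z.2.2 | z <- m']; split=> //; first by rewrite size_map.
    by move=> ys /mapP[z /(mem_subseq sm') /hm[_ ? _] ->].
  move: pw; rewrite -e !pairwise_map => /(subseq_pairwise sm').
  apply: (sub_in_pairwise (P := [in m])); last first.
    by apply/allP => z; apply: mem_subseq.
  by move=> u v /hm[u2 _ _] /hm[v2 _ _] /=; apply: allrel_incl.
- move=> y /flattenP[zs /mapP[z zin ->] yz].
  have [_ _ /(_ _ yz)->] := hm z (mem_subseq sm' zin).
  by apply/eqP; apply: (allP cm').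
Qed.

Definition homog (V : eqType) (T : finType) (chi : V -> V -> T) (ys zs : seq V) :=
  [exists c, allrel (fun y z => chi y z == c) ys zs].

(** The towers are treated in turn. The first is cut down to a bounded size, so
    that the other towers can be refined until each sees every vertex of it in
    one colour; then the first is refined according to these colours. *)
Lemma tow_homogenize (T : finType) (j p' L : nat) : 0 < p' -> exists2 p, p' <= p &
  forall (V : eqType) (chi : V -> V -> T) (C : seq T) (xss : seq (seq V)),
  size C = j -> size xss = L -> (forall xs, xs \in xss -> tow chi C p xs) ->
  exists yss, [/\ all2 (@incl V) yss xss, forall ys, ys \in yss -> tow chi C p' ys
                 & pairwise (homog chi) yss].
Proof.
move=> p'0; elim: L => [|L [pL _ IH]].
  by exists p'; [apply: leqnn|move=> V chi C [|//] _ _ _; exists [::]].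
have [p0 hp0] := tow_ramsey {ffun 'I_L -> T} j p'.
have [p1 hp1] := tow_ramsey unit j p0.
have [p2 hp2] := tow_ramsey {ffun 'I_(p0 ^ j) -> T} j pL.
pose p := maxn p' (maxn p1 p2).
have [lep le1 le2] : [/\ p' <= p, p1 <= p & p2 <= p] by rewrite /p; split; lia.
exists p => // V chi C [//|xs xss] zC [zxss] hxs.
have [xs0 [_ [xs0s txs0 _]]] :=
  hp1 _ le1 _ _ chi C xs (fun=> tt) zC (hxs _ (mem_head _ _)).
have zxs0 : size xs0 = p0 ^ j by rewrite (size_tow txs0) zC.
have [zs zin|m e hm] := @seq_choice _ _ (fun zs ys : seq V =>
    [/\ incl ys zs, tow chi C pL ys & forall x y y', x \in xs0 -> y \in ys ->
      y' \in ys -> chi x y = chi x y']) xss.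
  have tzs : tow chi C p zs by apply: hxs; rewrite inE zin orbT.
  pose f (v : V) := [ffun i : 'I_(p0 ^ j) => chi (nth v xs0 i) v].
  have [ys [d [h1 h2 h3]]] := hp2 _ le2 _ _ chi C zs f zC tzs.
  exists ys; split=> // x y y' xin yin y'in.
  have lt : index x xs0 < p0 ^ j by rewrite -zxs0 index_mem.
  have ev v : f v (Ordinal lt) = chi x v by rewrite ffunE /= nth_index.
  by rewrite -!ev !h3.
have zm : size (unzip2 m) = L by rewrite -zxss -e !size_map.
have [ys yin|yss [yss2 tyss hyss]] := IH V chi C (unzip2 m) zC zm.
  by case/mapP: yin => z /hm[_ ? _] ->.
pose h x := [ffun i : 'I_L => chi x (head x (nth [::] (unzip2 m) i))].
have [ys [d [ysx tys hys]]] := hp0 p0 (leqnn _) _ _ chi C xs0 h zC txs0.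
exists (ys :: yss); split.
- rewrite /= (incl_trans ysx) //=.
  apply: (all2_trans_sub (fun x y z => @incl_trans V y x z)) yss2 _.
  rewrite -e; elim: m hm {e zm h hys IH zxss hxs} => //= z m IH' hm.
  have [-> _ _] := hm z (mem_head _ _); apply: IH' => u um.
  by apply: hm; rewrite inE um orbT.
- by move=> zs; rewrite inE => /predU1P[->|/tyss].
- rewrite /= hyss andbT; apply/allP => zs zin.
  have lt : index zs yss < L.
    by move: zin yss2; rewrite -index_mem all2E -zm => ? /andP[/eqP <-].
  apply/existsP; exists (d (Ordinal lt)); apply/allrelP => y z yin zzs.
  have := all2_nth [::] [::] yss2 (_ : index zs yss < size yss).
  rewrite index_mem nth_index // => /(_ zin)/inclP/(_ _ zzs).
  rewrite -(hys y yin) ffunE /=; set us := nth _ _ _ => zus.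
  have usm : us \in unzip2 m by apply: mem_nth; rewrite zm.
  case/mapP: usm => u um eu; have [_ _ hu] := hm u um.
  apply/eqP; apply: hu; rewrite -?eu //; first exact: (inclP _ _ ysx).
  by case: (us) zus => // v vs _; rewrite mem_head.
Qed.

(** Complete pairs of cliques in one colour are the links from which a power of
    a path is built. *)
Definition bip (V : finType) (T : eqType) (chi : V -> V -> T) q c (xs ys : seq V) :=
  [exists I : q.-tuple V, exists J : q.-tuple V,
    [&& incl I xs, incl J ys, pairwise (cc chi c) I, pairwise (cc chi c) J
      & allrel (cc chi c) I J]].

Lemma bipP (V : finType) (T : eqType) (chi : V -> V -> T) q c (xs ys : seq V) :
  reflect (exists I J, [/\ size I = q /\ size J = q, incl I xs, incl J ys,
      pairwise (cc chi c) I /\ pairwise (cc chi c) J & allrel (cc chi c) I J])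
    (bip chi q c xs ys).
Proof.
apply: (iffP existsP) => [[I /existsP[J /and5P[? ? ? ? ?]]]|[I [J]]].
  by exists I, J; rewrite !size_tuple.
case=> -[/eqP zI /eqP zJ] ? ? [? ?] ?.
by exists (Tuple zI); apply/existsP; exists (Tuple zJ); apply/and5P.
Qed.

Lemma bip_sym (V : finType) (T : eqType) (chi : V -> V -> T) q c :
  (forall x y, chi x y = chi y x) -> symmetric (bip chi q c).
Proof.
move=> chiS; suff half xs ys : bip chi q c xs ys -> bip chi q c ys xs.
  by move=> xs ys; apply/idP/idP; apply: half.
case/bipP=> I [J [[zI zJ] Ix Jy [pI pJ] IJ]]; apply/bipP; exists J, I.
by split=> //; rewrite allrelC (eq_allrel (r' := cc chi c)) // => x y; rewrite cc_sym.
Qed.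

Lemma bip_incl (V : finType) (T : eqType) (chi : V -> V -> T) q c xs ys xs' ys' :
  incl xs' xs -> incl ys' ys -> bip chi q c xs' ys' -> bip chi q c xs ys.
Proof.
move=> hx hy /bipP[I [J [zz Ix Jy cl IJ]]]; apply/bipP; exists I, J.
by split=> //; [apply: incl_trans hx|apply: incl_trans hy].
Qed.

(** Between homogeneous towers over [C] a colour of [C] would complete two
    cliques of that colour to a forbidden configuration, so a Ramsey clique of
    towers comes in a new colour. *)
Lemma tow_extend (T : finType) (j p' q : nat) : q <= p' -> 1 < p' -> exists p L,
  p' <= p /\ forall (V : finType) (chi : V -> V -> T) (C : seq T) (xss : seq (seq V)),
  (forall x y, chi x y = chi y x) -> size C = j -> size xss = L.+1 ->
  (forall xs, xs \in xss -> tow chi C p xs) ->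
  pairwise (fun xs ys : seq V => ~~ has [in xs] ys) xss ->
  pairwise (fun xs ys => all (fun c => ~~ bip chi q c xs ys) C) xss ->
  exists c yss, [/\ c \notin C, tow chi (c :: C) p' (flatten yss),
    pairwise (allrel (cc chi c)) yss
    & forall ys, ys \in yss -> exists2 xs, xs \in xss & incl ys xs].
Proof.
move=> qp' p'1; have p'0 : 0 < p' by apply: ltnW.
have [L hL] := ramsey (option T) p'.
have [p lep hp] := @tow_homogenize T j p' L.+1 p'0; exists p, L; split=> //.
move=> V chi C xss chiS zC zxss txss dis nobip.
have [yss [yssx tyss hyss]] := hp V chi C xss zC zxss txss.
have zyss : size yss = L.+1 by move: yssx; rewrite all2E zxss => /andP[/eqP].
pose phi ys zs := [pick c | allrel (fun y z => chi y z == c) ys zs].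
have [|o [l [sl zl pl]]] := hL _ phi yss; first by rewrite zyss.
have {dis} dis : pairwise (fun xs ys : seq V => ~~ has [in xs] ys) l.
  apply: subseq_pairwise sl _; apply: all2_pairwise yssx dis.
  move=> xs ys xs' ys' /inclP hx /inclP hx' /hasPn hd; apply/hasPn => x /hx' xy.
  by apply: contra (hd x xy); apply: hx.
have {nobip} nobip : pairwise (fun xs ys => all (fun c => ~~ bip chi q c xs ys) C) l.
  apply: subseq_pairwise sl _; apply: all2_pairwise yssx nobip.
  move=> xs ys xs' ys' hx hx' /allP hd; apply/allP => c /hd; apply: contra.
  exact: bip_incl.
have {}hyss := subseq_pairwise sl hyss.
have [c o_c] : exists c, o = Some c.
  case: l zl pl hyss {sl dis nobip} => [|ys [|zs l]] /=; try by move=> e; rewrite -e in p'1.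
  move=> _ /andP[/andP[/eqP <- _] _] /andP[/andP[/existsP[c hc] _] _].
  by rewrite /phi; case: pickP => [d _|/(_ c)]; [exists d|rewrite hc].
have col : pairwise (allrel (fun y z => chi y z == c)) l.
  apply: sub_pairwise pl => ys zs; rewrite o_c /phi.
  by case: pickP => // d hd /eqP[<-].
have ccl : pairwise (allrel (cc chi c)) l.
  have := conj col dis => /andP; rewrite -pairwise_relI; apply: sub_pairwise.
  move=> ys zs /= /andP[/allrelP h1 /hasPn h2]; apply/allrelP => y z yin zin.
  by rewrite /cc h1 // andbT; apply: contraNneq (h2 z zin) => <-.
have tl ys : ys \in l -> tow chi C p' ys by move/(mem_subseq sl)/tyss.
exists c, l; split=> //.
- apply/negP => cC.
  case: l zl {sl pl col dis hyss} nobip ccl tl => [|ys [|zs l]] /=;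
    try by move=> e; rewrite -e in p'1.
  move=> _ /andP[/andP[/allP/(_ c cC)/negP nb _] _] /andP[/andP[yz _] _] tl.
  apply: nb.
  have [I [zI Iy cI]] := tow_clique p'0 (tl ys (mem_head _ _)) cC.
  have [|J [zJ Jz cJ]] := tow_clique p'0 (tl zs _) cC; first by rewrite !inE eqxx orbT.
  have tk K : incl (take q K) K by apply/inclP => x; apply: mem_take.
  apply/bipP; exists (take q I), (take q J); split.
  + by rewrite !size_takel ?zI ?zJ.
  + exact: incl_trans Iy.
  + exact: incl_trans Jz.
  + by split; apply: subseq_pairwise (take_subseq _ _) _.
  + by apply: allrel_incl yz; [apply: incl_trans Iy|apply: incl_trans Jz].
- by exists l.
- by move=> ys /(mem_subseq sl)/(all2_mem yssx).
Qed.

(** Two vertices in different groups are joined in [c], whence a clique in another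
    colour does not meet two groups. *)
Lemma clique_in_group (V T : eqType) (chi : V -> V -> T) c d yss x I :
  (forall x y, chi x y = chi y x) -> pairwise (allrel (cc chi c)) yss -> d != c ->
  pairwise (cc chi d) (x :: I) -> incl (x :: I) (flatten yss) ->
  exists2 ys, ys \in yss & incl (x :: I) ys.
Proof.
move=> chiS pw ndc /andP[/allP xI _] /andP[/flattenP[ys yin xys] /inclP hI].
exists ys => //; rewrite /incl /= xys; apply/inclP => y yI.
have /flattenP[zs zin yzs] := hI y yI.
have [->//|nyz] := eqVneq ys zs.
have /andP[_ /eqP xy] := xI y yI.
suff /andP[_ /eqP e] : cc chi c x y by rewrite -xy e eqxx in ndc.
case/orP: (pairwise_mem pw yin zin nyz) => /allrelP h; first exact: h.
by rewrite cc_sym //; apply: h.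
Qed.

(** * From a path of towers to a power of a path *)

Fixpoint power_path (V : Type) (k : nat) (r : rel V) (zs : seq V) : bool :=
  if zs is x :: zs' then all (r x) (take k zs') && power_path k r zs' else true.

Lemma power_path_nth (V : Type) k (r : rel V) zs x0 i j :
  power_path k r zs -> i < j <= i + k -> j < size zs -> r (nth x0 zs i) (nth x0 zs j).
Proof.
elim: zs i j => [|x zs IH] i [|j]; rewrite ?ltn0 ?andbF //=.
case: i => [|i] /= /andP[hx hz]; last first.
  by rewrite addSn !ltnS => le lt; apply: IH.
rewrite add0n ltnS => le lj; rewrite -(@nth_take k) //.
by move/all_nthP: hx; apply; rewrite size_take; case: ifP.
Qed.

Lemma power_path_cat (V : Type) k (r : rel V) B zs :
  pairwise r B -> size B <= k -> allrel r B (take k zs) -> power_path k r zs ->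
  power_path k r (B ++ zs).
Proof.
elim: B => //= x B IH /andP[xB pB] zB; rewrite allrel_consl => /andP[xz Bz] hz.
rewrite IH ?andbT //; last exact: ltnW.
rewrite take_cat ltnNge (ltnW zB) /= all_cat xB /=.
rewrite -(@take_takel _ (k - size B) k) ?leq_subr //.
by move: xz; rewrite -{1}(cat_take_drop (k - size B) (take k zs)) all_cat => /andP[].
Qed.

(** Places at distance at most [k] belong to the same block of length [k] or to
    consecutive ones. *)
Lemma power_path_flatten (V : eqType) k (r : rel V) (Bs : seq (seq V)) :
  (forall B, B \in Bs -> size B = k /\ pairwise r B) -> sorted (allrel r) Bs ->
  power_path k r (flatten Bs).
Proof.
elim: Bs => //= B Bs IH hB pB.
have [zB rB] := hB B (mem_head _ _).
apply: power_path_cat => //; first by rewrite zB.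
- case: Bs pB hB {IH} => [|B' Bs] /=; first by rewrite allrel0r.
  case/andP=> BB' _ hB; have [|zB' _] := hB B'; first by rewrite !inE eqxx orbT.
  by rewrite take_cat zB' ltnn subnn take0 cats0.
- apply: IH; last exact: path_sorted pB.
  by move=> B' B'in; apply: hB; rewrite inE B'in orbT.
Qed.

Lemma select_joined (V T : eqType) (chi : V -> V -> T) c (xs I J : seq V) :
  (forall x y, chi x y = chi y x) ->
  (forall x y z, x \in xs -> y \in xs -> z \in xs ->
    ~~ cc chi c x y -> ~~ cc chi c y z -> ~~ cc chi c x z) ->
  incl I xs -> incl J xs -> pairwise (cc chi c) I ->
  exists I', [/\ subseq I' I, allrel (cc chi c) J I' & size I <= size J + size I'].
Proof.
move=> chiS trans Ix Jx pI; elim: J Jx => [|x J IH] /=.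
  by exists I; rewrite subseq_refl leqnn.
case/andP=> xx /IH[I' [sI JI zI]].
exists (filter (cc chi c x) I'); split.
- exact: subseq_trans (filter_subseq _ _) sI.
- rewrite allrel_consl filter_all /=.
  by apply/allrelP => y z yJ; rewrite mem_filter => /andP[_]; apply: (allrelP JI).
have {}sI' : incl I' xs by apply/inclP => y /(mem_subseq sI); apply: (inclP _ _ Ix).
(* a vertex misses at most one member of a clique: missing is transitive *)
have one : count (predC (cc chi c x)) I' <= 1.
  rewrite -size_filter.
  have := subseq_pairwise (subseq_trans (filter_subseq (predC (cc chi c x)) _) sI) pI.
  have : {subset filter (predC (cc chi c x)) I' <= [pred y | (y \in xs) && ~~ cc chi c x y]}.
    by move=> y; rewrite mem_filter /= inE => /andP[-> /(inclP _ _ sI')->].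
  case: (filter _ _) => [|y [|z l]] //= h /andP[/andP[yz _] _].
  have /andP[yx xy] := h y (mem_head _ _).
  have /andP[zx xz] : z \in [pred y | (y \in xs) && ~~ cc chi c x y].
    by apply: h; rewrite !inE eqxx orbT.
  by have := trans y x z yx xx zx; rewrite yz cc_sym // xy xz => /(_ isT isT).
have := count_predC (cc chi c x) I'; rewrite size_filter; lia.
Qed.

Definition cc_near (V : finType) (T : eqType) (g : rel V) (chi : V -> V -> T) c r :=
  [rel x y | cc chi c x y && near g r x y].

(** Each tower on the path contributes a block joined to a block of the previous
    tower and a block joined to one of the next. The cliques provided by [bip]
    have twice the length of a block, so that the two blocks of a tower can be
    chosen joined to each other. *)
Lemma blocks_of_path (V : finType) (T : eqType) (g : rel V) (chi : V -> V -> T)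
    (S : V -> seq V) c C p k R d u us J :
  (forall x y, chi x y = chi y x) -> symmetric g -> reflexive g -> c \notin C ->
  (forall v, v \in u :: us -> tow chi (c :: C) p (S v)) ->
  (forall v x, v \in u :: us -> x \in S v -> near g d v x) ->
  (forall v w x, v \in u :: us -> w \in u :: us -> x \in S v -> x \in S w -> v = w) ->
  uniq (u :: us) ->
  path (fun u v => near g R u v && bip chi k.*2 c (S u) (S v)) u us ->
  size J = k -> incl J (S u) -> pairwise (cc chi c) J ->
  let r := cc_near g chi c (d + R + d) in
  exists Bs, [/\ size Bs = (size us).*2,
    forall B, B \in J :: Bs -> size B = k /\ pairwise r B, path (allrel r) J Bs,
    forall x, x \in flatten (J :: Bs) -> exists2 v, v \in u :: us & x \in S v
    & uniq (flatten (J :: Bs))].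
Proof.
move=> chiS gS gR cC + + + + + + + + r.
have ccI : irreflexive (cc chi c) by move=> x; rewrite /cc eqxx.
have inS (v : V) (I I' : seq V) : (forall x, x \in S v -> near g d v x) ->
    incl I (S v) -> incl I' (S v) -> allrel (cc chi c) I I' -> allrel r I I'.
  move=> nS /inclP Iv /inclP Iv' /allrelP h; apply/allrelP => x y xI yI.
  rewrite /r /= h //; apply: (near_leq gR (r := d + d)); first lia.
  by apply: near_add (nS y _); [rewrite near_sym ?nS ?Iv|apply: Iv'].
have inS1 (v : V) (I : seq V) : (forall x, x \in S v -> near g d v x) ->
    incl I (S v) -> pairwise (cc chi c) I -> pairwise r I.
  move=> nS /inclP Iv; apply: (sub_in_pairwise (P := [in S v])); last exact/allP.
  move=> x y xv yv xy; have := @inS v [:: x] [:: y] nS.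
  by rewrite !allrel1l /incl /= !andbT => /(_ xv yv xy).
elim: us u J => [|v us IH] u J tS nS dS uU pU zJ Ju pJ.
  exists [::]; rewrite /= cats0; split=> //.
  - by move=> B; rewrite inE => /eqP->; split=> //; apply: (inS1 u) => // x; apply: nS; rewrite mem_head.
  - by move=> x xJ; exists u; [rewrite mem_head|apply: (inclP _ _ Ju)].
  - exact: pairwise_uniq pJ.
have uin : u \in [:: u, v & us] by rewrite mem_head.
have vin : v \in [:: u, v & us] by rewrite !inE eqxx orbT.
case/andP: (uU) => nu uU'; case/andP: pU => /andP[uv /bipP[I [J2 [[zI zJ2] Iu J2v [pI pJ2] IJ2]]]] pU.
have [I' [sI JI' zI']] := select_joined chiS (fun x y z => tow_not_cc_trans chiS cC (tS u uin)
  (x := x) (y := y) (z := z)) Iu Ju pI.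
pose I1 := take k I'; pose J1 := take k J2.
have sI1 : subseq I1 I := subseq_trans (take_subseq _ _) sI.
have sJ1 : subseq J1 J2 := take_subseq _ _.
have I1u : incl I1 (S u) by apply/inclP => x /(mem_subseq sI1); apply: (inclP _ _ Iu).
have J1v : incl J1 (S v) by apply/inclP => x /(mem_subseq sJ1); apply: (inclP _ _ J2v).
have JI1 : allrel (cc chi c) J I1.
  apply: allrel_incl JI'; first exact/inclP.
  by apply/inclP => x; apply: mem_take.
have zI1 : size I1 = k.
  by apply: size_takel; move: zI'; rewrite zI zJ -addnn leq_add2l.
have zJ1 : size J1 = k by rewrite size_takel // zJ2 -addnn leq_addl.
have IJ1 : allrel r I1 J1.
  apply/allrelP => x y xI yJ; rewrite /r /=; apply/andP; split.
    by apply: (allrelP IJ2); [apply: mem_subseq xI|apply: mem_subseq yJ].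
  apply: near_add (nS v y vin ((inclP _ _ J1v) y yJ)).
  by apply: near_add uv; rewrite near_sym // nS // (inclP _ _ I1u).
have [|||||Bs [zBs hBs pBs fBs uBs]] := IH v J1 _ _ _ _ pU zJ1 J1v _.
- by move=> w win; apply: tS; rewrite inE win orbT.
- by move=> w x win; apply: nS; rewrite inE win orbT.
- by move=> w w' x win win'; apply: dS; rewrite inE ?win ?win' orbT.
- by [].
- exact: subseq_pairwise pJ2.
have nSu x : x \in S u -> near g d u x by apply: nS.
have pI1 : pairwise (cc chi c) I1 by apply: subseq_pairwise pI.
exists (I1 :: J1 :: Bs); split.
- by rewrite /= zBs.
- move=> B; rewrite inE => /predU1P[->|]; first by split=> //; apply: (inS1 u).
  by rewrite inE => /predU1P[->|/hBs//]; split=> //; apply: (inS1 u).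
- by rewrite /= IJ1 pBs (inS u).
- move=> x /=; rewrite 2!mem_cat => /or3P[xJ|xI|/fBs[w win xw]].
  + by exists u => //; apply: (inclP _ _ Ju).
  + by exists u => //; apply: (inclP _ _ I1u).
  + by exists w; rewrite // inE win orbT.
- rewrite /= catA cat_uniq uBs andbT; apply/andP; split.
    rewrite cat_uniq !(pairwise_uniq ccI) // andbT /=.
    apply/hasPn => x xI; apply/negP => xJ.
    by have := allrelP JI1 x x xJ xI; rewrite ccI.
  apply/hasPn => x /fBs[w win xw]; rewrite mem_cat; apply/negP => h.
  have xu : x \in S u by case/orP: h; [apply: (inclP _ _ Ju)|apply: (inclP _ _ I1u)].
  by move: nu; rewrite (dS u w x) ?win // inE win orbT.
Qed.

Lemma power_path_of_path (V : finType) (T : eqType) (g : rel V) (chi : V -> V -> T)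
    (S : V -> seq V) c C p k R d us :
  (forall x y, chi x y = chi y x) -> symmetric g -> reflexive g -> c \notin C ->
  0 < k -> k <= p ->
  (forall v, v \in us -> tow chi (c :: C) p (S v)) ->
  (forall v x, v \in us -> x \in S v -> near g d v x) ->
  (forall v w x, v \in us -> w \in us -> x \in S v -> x \in S w -> v = w) ->
  uniq us ->
  sorted (fun u v => near g R u v && bip chi k.*2 c (S u) (S v)) us ->
  exists zs, [/\ size us <= size zs, uniq zs
                & power_path k (cc_near g chi c (d + R + d)) zs].
Proof.
move=> chiS gS gR cC k0 kp; case: us => [|u us] tS nS dS uU pU; first by exists [::].
have [|I [zI Iu cI]] := tow_clique (leq_trans k0 kp) (tS u (mem_head _ _)) (c := c).
  by rewrite mem_head.
have zJ : size (take k I) = k by rewrite size_takel ?zI.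
have Ju : incl (take k I) (S u).
  by apply/inclP => x /mem_take; apply: (inclP _ _ Iu).
have pJ : pairwise (cc chi c) (take k I) by apply: subseq_pairwise (take_subseq _ _) cI.
have [Bs [zBs hBs pBs _ uBs]] := blocks_of_path chiS gS gR cC tS nS dS uU pU zJ Ju pJ.
exists (flatten (take k I :: Bs)); split=> //; last exact: power_path_flatten.
rewrite size_flatten (_ : sumn _ = size (take k I :: Bs) * k); last first.
  elim: (_ :: Bs) hBs => //= B Bs' IH hB; rewrite (hB B (mem_head _ _)).1 IH //.
  by move=> B' B'in; apply: hB; rewrite inE B'in orbT.
by rewrite /= zBs (leq_trans _ (leq_pmulr _ k0)) // ltnS -addnn leq_addr.
Qed.

(** * Transversal paths in an expander *)

(** By expansion, fewer than [a] vertices of the first set have no neighbour in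
    [Y], so the search can go on from at least [a] others. *)
Lemma transversal_from (V : finType) (g : rel V) a (Y : {set V}) (Ps : seq {set V}) :
  expands g a -> (forall P, P \in Ps -> a.*2 <= #|P|) -> 0 < a <= #|Y| ->
  exists v ws, [/\ v \in Y, path g v ws & all2 (fun w (P : {set V}) => w \in P) ws Ps].
Proof.
move=> gX; elim: Ps Y => [|P Ps IH] Y hP /andP[a0 aY].
  have /card_gt0P[v vY] := leq_trans a0 aY.
  by exists v, [::].
pose Y' := [set w in P | [exists v in Y, g v w]].
have aY' : a <= #|Y'|.
  rewrite leqNgt; apply/negP => lt.
  have aPY : a <= #|P :\: Y'|.
    have := hP P (mem_head _ _); have := cardsID Y' P.
    by have := subset_leq_card (subsetIr P Y'); lia.
  have [v [w [vY /setDP[wP wY'] vw]]] := gX _ _ aY aPY.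
  by case/negP: wY'; rewrite inE wP; apply/exists_inP; exists v.
have [||w [ws [/setIdP[wP /exists_inP[v vY vw]] pw aw]]] := IH Y'.
- by move=> Q Qin; apply: hP; rewrite inE Qin orbT.
- by rewrite a0.
- by exists v, (w :: ws); rewrite /= vw wP.
Qed.

(** Greedily: the bound on the sizes leaves room for removing the vertices of the
    transversals found before. *)
Lemma disjoint_transversals (V : finType) (g : rel V) a M P (Ps : seq {set V}) :
  expands g a -> 0 < a ->
  (forall Q, Q \in P :: Ps -> a.*2 + M * (size Ps).+1 <= #|Q|) ->
  exists (X : {set V}) (t : V -> seq V), [/\ X \subset P, #|X| = M,
    forall v, v \in X ->
      path g v (t v) /\ all2 (fun w (P : {set V}) => w \in P) (t v) Ps
    & forall u v w, u \in X -> v \in X -> w \in u :: t u -> w \in v :: t v -> u = v].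
Proof.
move=> gX a0; elim: M => [|M IH] hM.
  exists set0, (fun=> [::]); split; rewrite ?sub0set ?cards0 //.
    by move=> v; rewrite inE.
  by move=> u v w; rewrite inE.
have [|X [t [XP zX pt dt]]] := IH.
  by move=> Q /hM; apply: leq_trans; rewrite mulSn; lia.
pose used := \bigcup_(v in X) [set w in v :: t v].
have hused : #|used| <= M * (size Ps).+1.
  rewrite -zX -sum_nat_const /used.
  elim/big_rec2: _ => [|v n Z vX le]; first by rewrite cards0.
  apply: leq_trans (leq_card_setU _ _) _; apply: leq_add le.
  rewrite cardsE; apply: leq_trans (card_size _) _ => /=; rewrite ltnS.
  by have [_] := pt v vX; rewrite all2E => /andP[/eqP->].
have big Q : Q \in P :: Ps -> a.*2 <= #|Q :\: used|.
  move=> /hM; have := cardsID used Q; have := subset_leq_card (subsetIr Q used).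
  by rewrite mulSn; lia.
have [||v [ws [/setDP[vP vn] pv av]]] :=
    @transversal_from _ g a (P :\: used) [seq Q :\: used | Q <- Ps] gX.
- by move=> _ /mapP[Q Qin ->]; apply: big; rewrite inE Qin orbT.
- by have := big P (mem_head _ _); rewrite a0 /=; lia.
have wsP : all2 (fun w (P : {set V}) => w \in P) ws Ps /\ all [predC used] ws.
  elim: Ps ws av {IH hM pt hused big pv} => [|Q Ps IH] [|w ws] //=.
  by case/andP=> /setDP[-> ->] /IH[-> ->].
case: wsP => wsP wsn.
have usedP u w : u \in X -> w \in u :: t u -> w \in used.
  by move=> uX wu; apply/bigcupP; exists u; rewrite // inE.
have vX : v \notin X by apply: contra vn => vX; apply: (usedP v); rewrite ?mem_head.
have nX u w : u \in X -> w \in u :: t u -> w \notin v :: ws.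
  move=> uX /(usedP u w uX) wu; rewrite inE negb_or; apply/andP; split.
    by apply: contraNneq vn => <-.
  by apply: contraL wu => /(allP wsn).
have ne u : u \in X -> (u == v) = false.
  by move=> uX; apply/negbTE; apply: contraNneq vX => <-.
exists (v |: X), (fun u => if u == v then ws else t u); split.
- by rewrite subUset sub1set vP.
- by rewrite cardsU1 vX zX.
- move=> u /setU1P[->|uX]; first by rewrite eqxx.
  by rewrite ne //; apply: pt.
- move=> u u' w /setU1P[->|uX] /setU1P[->|u'X] //.
  + rewrite eqxx ne // => h1 h2; by move: (nX _ _ u'X h2); rewrite h1.
  + rewrite eqxx ne // => h1 h2; by move: (nX _ _ uX h1); rewrite h2.
  + by rewrite !ne //; apply: dt.
Qed.

(** * Families of towers, and elimination of colours *)

Definition link (V : finType) (T : eqType) (g : rel V) (chi : V -> V -> T) q R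
    (S : V -> seq V) c : rel V :=
  fun u v => near g R u v && bip chi q c (S u) (S v).

Definition sep (V : finType) (T : eqType) (g : rel V) (chi : V -> V -> T) q R
    (S : V -> seq V) C (P Q : {set V}) :=
  [disjoint P & Q] && all (fun c => noedge (link g chi q R S c) P Q) C.

Definition cover_seq (V : finType) (Ps : seq {set V}) : pred V :=
  fun v => has (fun P : {set V} => v \in P) Ps.

(** The colours of [C] are eliminated: [family_sep] excludes links in them between
    different sets. Injectivity keeps the towers disjoint, so that they can be
    merged and concatenated. *)
Record family (V : finType) (T : eqType) (g : rel V) (chi : V -> V -> T) q C p R d
    (S : V -> seq V) (Ps : seq {set V}) : Prop := Family {
  family_tow : forall v, cover_seq Ps v -> tow chi C p (S v);
  family_near : forall v x, cover_seq Ps v -> x \in S v -> near g d v x;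
  family_inj : forall u v x, cover_seq Ps u -> cover_seq Ps v ->
    x \in S u -> x \in S v -> u = v;
  family_sep : pairwise (sep g chi q R S C) Ps
}.

Lemma link_sym (V : finType) (T : eqType) (g : rel V) (chi : V -> V -> T) q R S c :
  (forall x y, chi x y = chi y x) -> symmetric g -> symmetric (link g chi q R S c).
Proof. by move=> chiS gS u v; rewrite /link near_sym // bip_sym. Qed.

(** Gathering the towers met by a transversal path and extending them yields a
    tower around the first vertex of the path; the colour is one
    shared by many paths. A clique in another colour stays inside one of the old towers. *)
Lemma group_extend (T : finType) (j p' q : nat) : q <= p' -> 1 < p' -> exists p L,
  p' <= p /\ forall (V : finType) (g : rel V) (chi : V -> V -> T) a M C R d S (Qs : seq {set V}),
  (forall x y, chi x y = chi y x) -> symmetric g -> reflexive g -> expands g a ->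
  0 < a -> 0 < M -> L.*2 <= R -> size C = j -> size Qs = L.+1 ->
  (forall Q, Q \in Qs -> a.*2 + (#|T| * M).+1 * L.+1 <= #|Q|) ->
  family g chi q C p R d S Qs ->
  exists c (X : {set V}) (S' : {ffun V -> seq V}),
  [/\ c \notin C, #|X| = M,
    forall v, v \in X -> [/\ cover_seq Qs v, tow chi (c :: C) p' (S' v),
      forall x, x \in S' v -> exists w, [/\ cover_seq Qs w, near g L v w & x \in S w]
      & forall e x I, e != c -> pairwise (cc chi e) (x :: I) -> incl (x :: I) (S' v) ->
          exists w, [/\ cover_seq Qs w, near g L v w & incl (x :: I) (S w)]]
    & forall u v x, u \in X -> v \in X -> x \in S' u -> x \in S' v -> u = v].
Proof.
move=> qp' p'1; have [p [L [lep hp]]] := @tow_extend T j p' q qp' p'1.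
exists p, L; split=> // V g chi a M C R d S [//|Q Qs] chiS gS gR gX a0 M0 LR zC [zQs] hQ fam.
have [|X [t [XQ zX tX dX]]] :=
    @disjoint_transversals _ g a (#|T| * M).+1 Q Qs gX a0.
  by rewrite zQs.
have covX v : v \in X -> all2 (fun w (P : {set V}) => w \in P) (v :: t v) (Q :: Qs).
  by move=> vX /=; rewrite (subsetP XQ) //; have [_] := tX v vX.
have cov v w : v \in X -> w \in v :: t v -> cover_seq (Q :: Qs) w.
  move=> vX /(all2_mem (covX v vX))[P Pin wP]; apply/hasP; by exists P.
have nearv v w : v \in X -> w \in v :: t v -> near g L v w.
  move=> vX wv; have [pv av] := tX v vX.
  have <- : size (t v) = L by move: av; rewrite all2E zQs => /andP[/eqP].
  exact: near_path.
pose good v (z : T * seq V) := [/\ z.1 \notin C, tow chi (z.1 :: C) p' z.2,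
  forall x, x \in z.2 -> exists2 w, w \in v :: t v & x \in S w
  & forall e x I, e != z.1 -> pairwise (cc chi e) (x :: I) -> incl (x :: I) z.2 ->
      exists2 w, w \in v :: t v & incl (x :: I) (S w)].
have [z hz] : exists z : V -> T * seq V, forall v, v \in X -> good v (z v).
  apply: (@fin_all_exists V (fun=> T * seq V)%type (fun v z => v \in X -> good v z)) => v.
  have [vX|vX] := boolP (v \in X); last by exists (chi v v, [::]).
  have rel_ws : pairwise (fun w w' => [&& w != w' &
      all (fun c => ~~ bip chi q c (S w) (S w')) C]) (v :: t v).
    have all_ws : all2 (fun w (P : {set V}) => (w \in P) && near g L v w)
        (v :: t v) (Q :: Qs).
      have := covX v vX; have : all (near g L v) (v :: t v).
        by apply/allP => w; apply: nearv.
      elim: (v :: t v) (Q :: Qs) => [|w ws IH] [|P Ps] //= /andP[-> hw] /andP[-> hP].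
      exact: IH.
    apply: all2_pairwise all_ws (family_sep fam).
    move=> w P w' P' /andP[wP vw] /andP[w'P' vw'] /andP[dis /allP noE]; apply/andP; split.
      by apply: contraTneq wP => ->; rewrite (disjointFl dis).
    apply/allP => c cC; have := noedgeP _ _ _ (noE c cC) w w' wP w'P'.
    rewrite /link (_ : near g R w w') //; apply: near_leq LR _ => //.
    by rewrite -addnn; apply: near_add vw'; rewrite near_sym.
  have [||||c [yss [cC tc pc yx]]] := hp V chi C (map S (v :: t v)) chiS zC.
  - by rewrite size_map; have := covX v vX; rewrite all2E => /andP[/eqP-> _] /=; rewrite zQs.
  - by move=> _ /mapP[w wv ->]; apply: (family_tow fam); apply: (cov v).
  - rewrite pairwise_map; apply: (sub_in_pairwise (P := [in v :: t v])) rel_ws.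
      move=> w w' wv w'v /= /andP[nw _]; apply/hasPn => x xw'; apply/negP => xw.
      by case/eqP: nw; apply: (family_inj fam) xw xw'; apply: (cov v).
    exact/allP.
  - by rewrite pairwise_map; apply: sub_pairwise rel_ws => w w' /andP[].
  - exists (c, flatten yss) => _; split=> //=.
    + move=> x /flattenP[ys /yx[_ /mapP[w wv ->] /inclP sw] xy].
      by exists w => //; apply: sw.
    + move=> e x I ec pI /(clique_in_group chiS pc ec pI)[ys /yx[_ /mapP[w wv ->] sw] sI].
      by exists w; [|apply: incl_trans sI sw].
have [|c [l [sl zl cl]]] := @pigeonhole_subseq _ _ (fun v => (z v).1) M (enum X).
  by rewrite -cardE zX.
have lX v : v \in l -> v \in X by move/(mem_subseq sl); rewrite mem_enum.
have ul : uniq l by apply: subseq_uniq sl (enum_uniq _).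
have cl1 v : v \in l -> (z v).1 = c by move=> vl; apply/eqP; apply: (allP cl).
exists c, [set v in l], [ffun v => (z v).2]; split.
- case: l zl {sl cl ul} lX cl1 => [e|v l _ lX cl1]; first by rewrite -e in M0.
  by have [] := hz v (lX v (mem_head _ _)); rewrite cl1 ?mem_head.
- by rewrite cardsE (card_uniqP ul).
- move=> v; rewrite inE ffunE => vl; have vX := lX v vl.
  have [_ tz oz kz] := hz v vX; rewrite cl1 // in tz kz; split=> //.
  + by apply: (cov v) => //; apply: mem_head.
  + move=> x /oz[w wv xw]; exists w.
    by split=> //; [apply: (cov v)|apply: nearv].
  + move=> e x I ec pI sI; have [w wv Iw] := kz e x I ec pI sI; exists w.
    by split=> //; [apply: (cov v)|apply: nearv].
- move=> u v x; rewrite !inE !ffunE => /lX uX /lX vX.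
  have [_ _ ou _] := hz u uX; have [_ _ ov _] := hz v vX.
  move=> /ou[w wu xw] /ov[w' wv xw'].
  have e : w = w' by apply: (family_inj fam) xw xw'; [apply: (cov u)|apply: (cov v)].
  by rewrite -e in wv; apply: dX wu wv.
Qed.

Lemma pairwise_flatten (V : eqType) (r : rel V) (l : seq (seq V)) :
  pairwise r (flatten l) -> pairwise (allrel r) l /\ (forall s, s \in l -> pairwise r s).
Proof.
elim: l => //= s l IH; rewrite pairwise_cat => /and3P[sl ps /IH[pl hl]].
split; last by move=> s'; rewrite inE => /predU1P[->|/hl].
rewrite pl andbT; apply/allP => s' s'l; apply: allrel_incl sl; first exact/inclP.
by apply/inclP => x xs'; apply/flattenP; exists s'.
Qed.

Lemma sub_power_path (V : Type) k (r r' : rel V) zs :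
  subrel r r' -> power_path k r zs -> power_path k r' zs.
Proof.
move=> rr'; elim: zs => //= x zs IH /andP[xz /IH->]; rewrite andbT.
by apply: sub_all xz => y; apply: rr'.
Qed.

Lemma sub_noedge (V : finType) (e : rel V) (A B A' B' : {set V}) :
  A' \subset A -> B' \subset B -> noedge e A B -> noedge e A' B'.
Proof.
move=> /subsetP AA /subsetP BB /noedgeP h; apply/noedgeP => u v /AA uA /BB.
exact: h.
Qed.

(** Induction on the number [t] of stages left; having eliminated [#|T|.+1]
    colours is absurd. The sets of the family are gathered into groups; every
    group produces many towers with one new colour, and enough groups agree on
    this colour. Either the new towers carry
    a long path of linked towers, or depth-first search yields large sets of
    them that eliminate the new colour. As different groups gave rise to these sets
    and cliques in an old colour lie inside old towers, the old colours remain
    eliminated, for a smaller radius. *)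
Lemma descent (T : finType) (k : nat) : 0 < k -> forall t, exists p l Lam R E,
  [/\ k.*2 <= p, 1 < p, 0 < Lam & 0 < l] /\
  forall (V : finType) (g : rel V) (chi : V -> V -> T) a C d S (Ps : seq {set V}),
  (forall x y, chi x y = chi y x) -> symmetric g -> reflexive g -> expands g a ->
  0 < a -> uniq C -> size C + t = #|T|.+1 -> size Ps = l ->
  (forall P, P \in Ps -> Lam * a <= #|P|) ->
  family g chi k.*2 C p R d S Ps ->
  exists c zs, [/\ a <= size zs, uniq zs
                 & power_path k (cc_near g chi c (E + d.*2)) zs].
Proof.
move=> k0; elim=> [|t [p1 [l1 [Lam1 [R1 [E1 [[kp1 p11 Lam10 l10] IH]]]]]]].
  (* a duplicate-free list cannot have more than [#|T|] colours *)
  exists k.*2, 1, 1, 0, 0; split; first by split=> //; lia.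
  move=> V g chi a C d S Ps _ _ _ _ _ uC; rewrite addn0 => zC.
  by have := max_card (mem C); rewrite (card_uniqP uC) zC ltnn.
have [p [L [lep hp]]] := @group_extend T (#|T| - t) p1 k.*2 kp1 p11.
have [Lam2 Lam20 split_all] := dfs_split_all l1 Lam10.
(* enough groups for [l1] of them to agree on the new colour *)
pose G := (#|T| * l1).+1.
pose Lam := 2 + (#|T| * Lam2 + 1) * L.+1.
exists p, (G * L.+1), Lam, (R1 + L.*2), (E1 + R1 + L.*2).
split; first by split=> //; [lia|lia].
move=> V g chi a C d S Ps chiS gS gR gX a0 uC zC zPs hPs fam.
pose Qss := reshape (nseq G L.+1) Ps.
have fQ : flatten Qss = Ps by rewrite reshapeKr // sumn_nseq zPs mulnC.
have zQss : size Qss = G by rewrite size_reshape size_nseq.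
have shQ : shape Qss = nseq G L.+1 by rewrite reshapeKl // sumn_nseq zPs mulnC.
have := family_sep fam; rewrite -{1}fQ => /pairwise_flatten[sepQss sepQs].
have QsPs Qs Q : Qs \in Qss -> Q \in Qs -> Q \in Ps.
  by move=> h1 h2; rewrite -fQ; apply/flattenP; exists Qs.
have covPs Qs v : Qs \in Qss -> cover_seq Qs v -> cover_seq Ps v.
  move=> h1 /hasP[Q h2 vQ]; apply/hasP; exists Q => //; exact: QsPs h2.
have [Qs Qin|m mQ hm] := @seq_choice _ _ (fun Qs (z : T * ({set V} * {ffun V -> seq V})%type) =>
  [/\ z.1 \notin C, #|z.2.1| = Lam2 * a,
    forall v, v \in z.2.1 -> [/\ cover_seq Qs v, tow chi (z.1 :: C) p1 (z.2.2 v),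
      forall x, x \in z.2.2 v -> exists w, [/\ cover_seq Qs w, near g L v w & x \in S w]
      & forall e x I, e != z.1 -> pairwise (cc chi e) (x :: I) -> incl (x :: I) (z.2.2 v) ->
          exists w, [/\ cover_seq Qs w, near g L v w & incl (x :: I) (S w)]]
    & forall u v x, u \in z.2.1 -> v \in z.2.1 -> x \in z.2.2 u -> x \in z.2.2 v -> u = v])
  Qss.
  have [|||||c [X [S' h]]] := hp V g chi a (Lam2 * a) C (R1 + L.*2) d S Qs
    chiS gS gR gX a0 _ (leq_addl _ _).
  - by rewrite muln_gt0 Lam20.
  - by lia.
  - have : size Qs \in shape Qss by apply: map_f.
    by rewrite shQ => /nseqP[].
  - move=> Q QQ; apply: leq_trans (hPs Q (QsPs _ _ Qin QQ)).
    by rewrite /Lam; nia.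
  - split.
    + by move=> v vQ; apply: (family_tow fam); apply: covPs vQ.
    + by move=> v x vQ; apply: (family_near fam); apply: covPs vQ.
    + by move=> u v x uQ vQ; apply: (family_inj fam); [apply: covPs uQ|apply: covPs vQ].
    + exact: sepQs.
  - by exists (c, (X, S')).
have [|c [m' [sm' zm' cm']]] :=
    @pigeonhole_subseq _ _ (fun z : seq {set V} * (T * ({set V} * {ffun V -> seq V})) => z.2.1) l1 m.
  by rewrite -(size_map fst) -/(unzip1 m) mQ zQss.
have mm' z : z \in m' -> z \in m by apply: mem_subseq.
have zQ z : z \in m' -> z.1 \in Qss by move=> /mm' zm; rewrite -mQ map_f.
have zc z : z \in m' -> z.2.1 = c by move=> zm; apply/eqP; apply: (allP cm').
have sepm : pairwise (fun z z' => allrel (sep g chi k.*2 (R1 + L.*2) S C) z.1 z'.1) m'.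
  by move: sepQss; rewrite -mQ pairwise_map; apply: subseq_pairwise.
have uniq_cov z z' w : z \in m' -> z' \in m' -> cover_seq z.1 w -> cover_seq z'.1 w -> z = z'.
  move=> zm z'm /hasP[Q Qz wQ] /hasP[Q' Qz' wQ']; apply/eqP; apply: wlog_neg => nz.
  case/orP: (pairwise_mem sepm zm z'm nz) => /allrelP h.
    by have /andP[dis _] := h Q Q' Qz Qz'; rewrite (disjointFr dis wQ) in wQ'.
  by have /andP[dis _] := h Q' Q Qz' Qz; rewrite (disjointFl dis wQ) in wQ'.
pose over (v : V) := [pred z : seq {set V} * (T * ({set V} * {ffun V -> seq V})) |
  v \in z.2.2.1].
(* the sets are disjoint, so the towers of all groups form one function *)
pose S1 v := if filter (over v) m' is z :: _ then z.2.2.2 v else [::].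
have S1E z v : z \in m' -> v \in z.2.2.1 -> S1 v = z.2.2.2 v.
  move=> zm vz; rewrite /S1.
  have : z \in filter (over v) m' by rewrite mem_filter /= vz.
  have : {subset filter (over v) m' <= [pred z | over v z && (z \in m')]}.
    by move=> z'; rewrite mem_filter.
  case: (filter _ _) => // z' l h _.
  have /andP[vz' z'm] := h z' (mem_head _ _).
  have [_ _ /(_ _ vz)[cz _ _ _] _] := hm z (mm' z zm).
  have [_ _ /(_ _ vz')[cz' _ _ _] _] := hm z' (mm' z' z'm).
  by rewrite (uniq_cov z z' v).
have cC : c \notin C.
  case: m' zm' zc mm' {sm' cm' zQ sepm uniq_cov S1 S1E} => [e|z m' _ zc mm'].
    by rewrite -e in l10.
  by rewrite -(zc z (mem_head _ _)); have [] := hm z (mm' z (mem_head _ _)).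
have hS1 z v : z \in m' -> v \in z.2.2.1 -> [/\ cover_seq z.1 v,
      tow chi (c :: C) p1 (S1 v),
      forall x, x \in S1 v -> exists w, [/\ cover_seq z.1 w, near g L v w & x \in S w]
      & forall e x I, e \in C -> pairwise (cc chi e) (x :: I) -> incl (x :: I) (S1 v) ->
          exists w, [/\ cover_seq z.1 w, near g L v w & incl (x :: I) (S w)]].
  move=> zm vz; rewrite (S1E z v zm vz).
  have [_ _ /(_ v vz)[cz tz oz kz] _] := hm z (mm' z zm); rewrite zc // in tz kz.
  by split=> // e x I eC; apply: kz; apply: contraNneq cC => <-.
pose Xs := [seq z.2.2.1 | z <- m'].
have XsP v : cover_seq Xs v -> exists2 z, z \in m' & v \in z.2.2.1.
  by case/hasP=> _ /mapP[z zm ->]; exists z.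
have tow1 v : cover_seq Xs v -> tow chi (c :: C) p1 (S1 v).
  by case/XsP=> z zm /(hS1 z v zm)[].
have near1 v x : cover_seq Xs v -> x \in S1 v -> near g (d + L) v x.
  case/XsP=> z zm /(hS1 z v zm)[_ _ oz _] /oz[w [wz vw xw]].
  by rewrite addnC; apply: near_add vw (family_near fam (covPs _ _ (zQ z zm) wz) xw).
have inj1 u v x : cover_seq Xs u -> cover_seq Xs v -> x \in S1 u -> x \in S1 v -> u = v.
  case/XsP=> z zm uz /XsP[z' z'm vz'] xu xv.
  have [_ _ /(_ x xu)[w [wz _ xw]] _] := hS1 z u zm uz.
  have [_ _ /(_ x xv)[w' [wz' _ xw']] _] := hS1 z' v z'm vz'.
  have e : w = w'.
    by apply: (family_inj fam) xw xw'; [apply: covPs wz|apply: covPs wz']; apply: zQ.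
  have e' : z = z' by apply: uniq_cov wz _ => //; rewrite e.
  rewrite -e' in vz'; have [_ _ _ ij] := hm z (mm' z zm).
  by apply: (ij u v x uz vz'); rewrite -(S1E z).
have sep1 : pairwise (sep g chi k.*2 R1 S1 C) Xs.
  rewrite pairwise_map; apply: (sub_in_pairwise (P := [in m'])) sepm; last exact/allP.
  move=> z z' zm z'm /allrelP hz /=; apply/andP; split.
    rewrite -setI_eq0 -subset0; apply/subsetP => v /setIP[vz vz'].
    have [/hasP[Q Qz vQ] _ _ _] := hS1 z v zm vz.
    have [/hasP[Q' Qz' vQ'] _ _ _] := hS1 z' v z'm vz'.
    by have /andP[dis _] := hz Q Q' Qz Qz'; rewrite (disjointFr dis vQ) in vQ'.
  apply/allP => e eC; apply/noedgeP => u v uz vz'.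
  apply/negP => /andP[uv /bipP[I [J [[zI zJ] Iu Jv [pI pJ] IJ]]]].
  have k20 : 0 < k.*2 by rewrite double_gt0.
  case: I J zI zJ Iu Jv pI pJ IJ => [|x I] [|y J];
    try by [move=> zI; rewrite -zI in k20|move=> _ zJ; rewrite -zJ in k20].
  move=> zI zJ Iu Jv pI pJ IJ.
  have [_ _ _ ku] := hS1 z u zm uz; have [w [wz uw Iw]] := ku e x I eC pI Iu.
  have [_ _ _ kv] := hS1 z' v z'm vz'; have [w' [wz' vw' Jw']] := kv e y J eC pJ Jv.
  case/hasP: wz => Q Qz wQ; case/hasP: wz' => Q' Qz' wQ'.
  have /andP[_ /allP/(_ e eC)/noedgeP/(_ w w' wQ wQ')/negP] := hz Q Q' Qz Qz'.
  apply; apply/andP; split; last by apply/bipP; exists (x :: I), (y :: J).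
  rewrite -addnn addnA [R1 + L]addnC.
  apply: near_add vw'; apply: near_add uv; by rewrite near_sym.
have zXs : size Xs = l1 by rewrite size_map.
have [X|[us [zus uus sus hus]]|[Ys sYs noYs]] :=
    split_all V (link g chi k.*2 R1 S1 c) a Xs (link_sym _ _ _ _ chiS gS) a0 zXs.
- by case/mapP=> z zm ->; have [_ -> _ _] := hm z (mm' z zm).
- have cus v : v \in us -> cover_seq Xs v by move=> /hus[X Xin vX]; apply/hasP; exists X.
  have kp : k <= p1 by move: kp1; clear; lia.
  have [|||zs [lzs uzs pzs]] := @power_path_of_path V T g chi S1 c C p1 k R1 (d + L) us
      chiS gS gR cC k0 kp _ _ _ uus sus.
  + by move=> v /cus; apply: tow1.
  + by move=> v x /cus; apply: near1.
  + by move=> v w x /cus h /cus; apply: inj1.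
  + exists c, zs; split=> //; first by rewrite -zus.
    apply: sub_power_path pzs => x y /andP[xy nxy] /=; rewrite xy.
    by apply: near_leq nxy => //; clear; lia.
- have covY v : cover_seq Ys v -> cover_seq Xs v.
    case/hasP=> Y /(all2_mem sYs)[X Xin /andP[/subsetP YX _]] vY.
    by apply/hasP; exists X; rewrite // YX.
  have [|||||c' [zs [lzs uzs pzs]]] := IH V g chi a (c :: C) (d + L) S1 Ys chiS gS gR gX a0.
  + by rewrite /= cC.
  + by rewrite /= addSn -addnS.
  + by move: sYs; rewrite all2E zXs => /andP[/eqP].
  + by move=> Y /(all2_mem sYs)[X _ /andP[]].
  + split.
    * by move=> v /covY; apply: tow1.
    * by move=> v x /covY; apply: near1.
    * by move=> u v x /covY h /covY; apply: inj1.
    * have sepY : pairwise (sep g chi k.*2 R1 S1 C) Ys.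
        apply: all2_pairwise sYs sep1 => Y X Y' X' /andP[YX _] /andP[YX' _].
        case/andP=> dis /allP no; apply/andP; split.
          exact: disjointWl YX (disjointWr YX' dis).
        by apply/allP => e /no; apply: sub_noedge.
      have := conj sepY noYs => /andP; rewrite -pairwise_relI; apply: sub_pairwise.
      by move=> Y Y' /= /andP[/andP[dis no] no']; rewrite /sep dis /= no' no.
  + exists c', zs; split=> //; apply: sub_power_path pzs => x y /andP[xy nxy] /=.
    by rewrite xy; apply: near_leq nxy => //; clear; lia.
Qed.

(** * The host graph *)

Lemma disjoint_large_sets (V : finType) (l b : nat) (X : {set V}) :
  l * b <= #|X| -> exists Ps : seq {set V}, [/\ size Ps = l,
    forall P, P \in Ps -> P \subset X /\ #|P| = b
    & pairwise (fun P Q : {set V} => [disjoint P & Q]) Ps].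
Proof.
elim: l X => [|l IH] X; first by exists [::].
rewrite mulSn => h.
have [P PX zP] := exists_subset_card (leq_trans (leq_addr _ _) h).
have [|Ps [zPs hPs dPs]] := IH (X :\: P).
  by have := cardsID P X; rewrite (setIidPr PX) zP; lia.
exists (P :: Ps); split=> /=; first by rewrite zPs.
- move=> Q; rewrite inE => /predU1P[->//|/hPs[QX zQ]]; split=> //.
  exact: subset_trans QX (subsetDl _ _).
- rewrite dPs andbT; apply/allP => Q /hPs[QX _]; rewrite disjoint_sym.
  by apply: disjointWl QX _; rewrite disjoints_subset subsetDr.
Qed.

(** The descent starts from an arbitrary splitting of the vertices, with single
    vertices as towers and no colour eliminated. *)
Lemma host_exists (T : finType) (k : nat) : 0 < k -> exists r D Lam, forall n, 0 < n ->
  exists (V : finType) (g : rel V), [/\ reflexive g, symmetric g, #|V| <= Lam * n,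
    forall u, #|[set v | g u v]| <= D
    & forall chi : V -> V -> T, (forall x y, chi x y = chi y x) ->
      exists c zs, [/\ n <= size zs, uniq zs & power_path k (cc_near g chi c r) zs]].
Proof.
move=> k0; have [p [l [Lam [R [E [[_ _ Lam0 l0] hd]]]]]] := descent T k0 #|T|.+1.
have [|D hD] := @exists_expander (l * Lam); first by rewrite muln_gt0 l0.
exists E, D, (l * Lam).*2 => n n0.
have [V [g [gR gS gX /andP[Vlo Vhi] gD]]] := hD n n0.
exists V, g; split=> // chi chiS.
have [|Ps [zPs hPs dPs]] := @disjoint_large_sets V l (Lam * n) setT.
  by rewrite cardsT mulnA.
rewrite -[E]addn0 -double0.
apply: (hd V g chi n [::] 0 (fun v => [:: v]) Ps) => //.
  by move=> P /hPs[_ ->].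
split=> [v _|v x _|u v x _ _|].
- by exists v.
- by rewrite inE /= eq_sym.
- by rewrite !inE => /eqP-> /eqP->.
- by apply: sub_pairwise dPs => P Q; rewrite /sep /= andbT.
Qed.

(** * Powers of cycles inside powers of paths *)

(** Going up along the even places and back along the odd ones puts cyclically
    consecutive vertices at most two places apart. *)
Definition fold_pos (n i : nat) := if i.*2 < n then i.*2 else (n - i).*2.-1.

Lemma fold_pos_lt n i : i < n -> fold_pos n i < n.
Proof. by rewrite /fold_pos; case: ifP; lia. Qed.

Lemma fold_pos_inj n i j : i < n -> j < n -> fold_pos n i = fold_pos n j -> i = j.
Proof. by rewrite /fold_pos; case: ifP; case: ifP; lia. Qed.

Lemma fold_pos_ordS n (i : 'I_n) :
  fold_pos n (ordS i) <= fold_pos n i + 2 /\ fold_pos n i <= fold_pos n (ordS i) + 2.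
Proof.
have lt := ltn_ord i; rewrite /fold_pos /=.
have [e|e] := eqVneq i.+1 n.
  rewrite e modnn; case: ifP; case: ifP; lia.
rewrite modn_small; last by rewrite ltn_neqAle e.
case: ifP; case: ifP; lia.
Qed.

Lemma fold_pos_cycle_path n (x : 'I_n) p :
  path (@cycle_adj n) x p ->
  fold_pos n (last x p) <= fold_pos n x + (size p).*2 /\
  fold_pos n x <= fold_pos n (last x p) + (size p).*2.
Proof.
elim: p x => [|y p IH] x /=; first by rewrite addn0.
case/andP=> /andP[_ xy] /IH[h1 h2].
have [h3 h4] : fold_pos n y <= fold_pos n x + 2 /\ fold_pos n x <= fold_pos n y + 2.
  by case/orP: xy => /eqP<-; have [] := fold_pos_ordS x; have [] := fold_pos_ordS y.
by move: h1 h2 h3 h4; clear; lia.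
Qed.

Lemma power_adj_has_path (H : sgraph) k (x y : H) :
  power_adj k x y -> exists2 d, d <= k & has_path d x y.
Proof.
case/and3P=> nxy /connectP[p0 p0x e]; rewrite {}e in nxy *.
case/shortenP: p0x => p px up _ dk.
exists (dist x (last x p)) => //.
have : has (fun d => has_path d x (last x p)) (iota 0 #|H|).
  apply/hasP; exists (size p).
    rewrite mem_iota add0n /=.
    by have := max_card (mem (x :: p)); rewrite (card_uniqP up).
  by apply/existsP; exists (in_tuple p); apply/and3P; split=> //=.
rewrite -[dist _ _]/(find _ _) => hs; have := nth_find 0 hs.
rewrite nth_iota ?add0n //; move: hs; by rewrite has_find size_iota.
Qed.

Lemma fold_pos_power n k (x y : 'I_n) :
  @power_adj (cycle_graph n) k x y ->
  fold_pos n y <= fold_pos n x + k.*2 /\ fold_pos n x <= fold_pos n y + k.*2.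
Proof.
case/power_adj_has_path=> d dk /existsP[p /and3P[px _ /eqP <-]].
have [h1 h2] := fold_pos_cycle_path px; rewrite size_tuple in h1 h2.
by split; [apply: leq_trans h1 _|apply: leq_trans h2 _]; rewrite leq_add2l leq_double.
Qed.

(** * The size-Ramsey number *)

(** Passing to hosts with fewer and fewer edges ends at the minimum. *)
Lemma size_ramsey_exists s H (G : sgraph) :
  arrows G H s -> exists2 r, is_size_ramsey s H r & r <= #|edges G|.
Proof.
have [m] := ubnP #|edges G|; elim: m G => // m IH G; rewrite ltnS => lem aG.
have [[G' [aG' lt]]|no] :=
    classic (exists G' : sgraph, arrows G' H s /\ #|edges G'| < #|edges G|).
  have [r hr le] := IH G' (leq_trans lt lem) aG'.
  by exists r => //; apply: leq_trans le (ltnW lt).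
exists #|edges G| => //; split; first by exists G.
move=> G' aG'; rewrite leqNgt; apply/negP => lt; apply: no.
by exists G'.
Qed.

Definition host_adj (V : finType) (g : rel V) r : rel V :=
  fun x y => (x != y) && near g r x y.

Lemma host_adj_sym (V : finType) (g : rel V) r :
  symmetric g -> symmetric (host_adj g r).
Proof. by move=> gS x y; rewrite /host_adj eq_sym near_sym. Qed.

Lemma host_adj_irr (V : finType) (g : rel V) r : irreflexive (host_adj g r).
Proof. by move=> x; rewrite /host_adj eqxx. Qed.

Definition host (V : finType) (g : rel V) r (gS : symmetric g) :=
  SGraph (host_adj_sym r gS) (@host_adj_irr V g r).

Lemma card_edges_host (V : finType) (g : rel V) r (gS : symmetric g) D :
  (forall u, #|[set v | g u v]| <= D) -> #|edges (host r gS)| <= #|V| * D ^ r.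
Proof.
move=> gD; apply: leq_trans (leq_imset_card _ _) _.
apply: leq_trans (_ : #|[set p : V * V | near g r p.1 p.2]| <= _).
  by apply/subset_leq_card/subsetP => p; rewrite !inE /= => /andP[].
rewrite -sum1_card (eq_bigl (fun p : V * V => near g r p.1 p.2)); last first.
  by move=> p; rewrite inE.
rewrite -(pair_big_dep predT (fun x y => near g r x y) (fun _ _ => 1)) /=.
rewrite -sum_nat_const; apply: leq_sum => x _.
rewrite sum1_card; apply: leq_trans (card_near r x gD).
by apply: subset_leq_card; apply/subsetP => y; rewrite inE.
Qed.

(** Nonadjacent pairs receive an arbitrary colour; the pairs that matter are at
    distance at most [r] in [g] and hence adjacent in the host. *)
Lemma host_arrows s k n (V : finType) (g : rel V) r (gS : symmetric g) :
  0 < s -> 0 < n ->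
  (forall chi : V -> V -> 'I_s, (forall x y, chi x y = chi y x) ->
    exists c zs, [/\ n <= size zs, uniq zs & power_path k.*2 (cc_near g chi c r) zs]) ->
  arrows (host r gS) (power (cycle_graph n) k) s.
Proof.
case: s => // s _ n0 hz col.
pose chi (x y : V) : 'I_s.+1 :=
  if insub [set x; y] is Some e then col e else ord0.
have chiS x y : chi x y = chi y x by rewrite /chi setUC.
have [c [zs [lzs uzs pzs]]] := hz chi chiS.
have [z0 _] : exists z0, z0 \in zs.
  by case: zs lzs {uzs pzs} => [|z zs _]; [rewrite leqNgt n0|exists z; rewrite mem_head].
pose f (i : power (cycle_graph n) k) : V := nth z0 zs (fold_pos n (i : 'I_n)).
have lt (i : 'I_n) : fold_pos n i < size zs.
  by apply: leq_trans lzs; apply: fold_pos_lt.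
have fcc (x y : power (cycle_graph n) k) : adj x y -> cc_near g chi c r (f x) (f y).
  move=> /= xy; have [h1 h2] := fold_pos_power xy.
  have ne : fold_pos n x != fold_pos n y.
    apply/eqP => /(fold_pos_inj (ltn_ord _) (ltn_ord _))/val_inj e.
    by move: xy; rewrite e power_adj_irr.
  rewrite /f; case: ltngtP ne => // lt_xy _.
    by apply: power_path_nth pzs _ _; rewrite ?lt_xy.
  have := @power_path_nth _ _ _ _ z0 (fold_pos n y) (fold_pos n x) pzs.
  rewrite lt_xy h2 lt => /(_ isT isT) /=.
  by rewrite cc_sym // near_sym.
exists f; split.
- move=> x y /eqP; rewrite nth_uniq // => /eqP e.
  by apply: val_inj; apply: (fold_pos_inj (ltn_ord _) (ltn_ord _) e).
- by move=> x y /fcc /andP[/andP[nxy _] nr]; apply/andP.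
- exists c => x y /fcc /andP[/andP[_ /eqP <-] _] e he.
  by rewrite /chi -he valK.
Qed.

Unset Implicit Arguments.

Theorem corollary1p3 (s k : nat) (hs : 1 <= s) (hk : 1 <= k) :
  exists K N : nat, forall n : nat, N <= n ->
    exists2 r : nat, is_size_ramsey s (power (cycle_graph n) k) r & r <= K * n.
Proof.
have [|r [D [Lam hh]]] := @host_exists 'I_s k.*2; first by rewrite double_gt0.
exists (Lam * D ^ r), 1 => n n0.
have [V [g [_ gS zV gD hz]]] := hh n n0.
have [m hm le] := size_ramsey_exists (@host_arrows s k n V g r gS hs n0 hz).
exists m => //; apply: leq_trans le _; apply: leq_trans (@card_edges_host V g r gS D gD) _.
by rewrite mulnAC leq_mul2r zV orbT.
Qed.
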